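(* Let $\alpha\in(0,1)$ and $c>0$. Let $K$ satisfy: $K\in L^1(\mathbb R)$ is bounded and continuous, $K\ge 0$, $K(0)>0$, and $K(x)=K(-x)$ for all $x\in\mathbb R$. Suppose there exist $\beta>1$ and $C_{alg}\ge0$ such that $\lim_{x\to+\infty}x^\beta K(x)=C_{alg}$. Put $\kappa=\int_{\mathbb R}K(y)\,dy$ and $\phi(z;c)=\int_0^{+\infty}g_\alpha(r)\,\mathcal K(z+cr)\,dr$ for $z\in\mathbb R$. Then $$\lim_{z\to-\infty}|z|^{\beta-1}(\kappa-\phi(z;c))=\frac{C_{alg}}{\beta-1}\quad\text{when }\beta<1+\alpha,$$ $$\lim_{z\to-\infty}|z|^{\alpha}(\kappa-\phi(z;c))=\frac{C_{alg}}{\beta-1}+\frac{\kappa c^\alpha}{\Gamma(1-\alpha)}\quad\text{when }\beta=1+\alpha,$$ $$\lim_{z\to-\infty}|z|^{\alpha}(\kappa-\phi(z;c))=\frac{\kappa c^\alpha}{\Gamma(1-\alpha)}\quad\text{when }\beta>1+\alpha.$$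
   Context: Notation: $\mathcal K(x)=\int_x^{+\infty}K(y)\,dy$; $E_{\alpha,\beta}(z)=\sum_{n=0}^\infty \frac{z^n}{\Gamma(\alpha n+\beta)}$ is the Mittag-Leffler function; $g_\alpha(t)=t^{\alpha-1}E_{\alpha,\alpha}(-t^\alpha)$ for $t>0$. *)

(* Defs.v *)
From HB Require Import structures.
From mathcomp Require Import all_boot all_order all_algebra.
From mathcomp Require Import all_classical all_reals all_analysis.

Set Implicit Arguments.
Unset Strict Implicit.
Unset Printing Implicit Defensive.

Import Order.TTheory GRing.Theory Num.Theory.
Import numFieldNormedType.Exports.

Local Open Scope classical_set_scope.
Local Open Scope ring_scope.

(* Euler's integral. It represents the Gamma function only for s > 0; the
   arguments needed here, alpha * n + beta with alpha, beta > 0 and 1 - alpha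
   with alpha < 1, are all positive. *)
Definition Gamma (R : realType) (s : R) : R :=
  \int[lebesgue_measure]_(x in `]0, +oo[) (x `^ (s - 1) * expR (- x)).

(* Intended for alpha, beta > 0, where the series converges for every z. *)
Definition mittag_leffler (R : realType) (alpha beta z : R) : R :=
  limn (series (fun n : nat => z ^+ n / Gamma (alpha * n%:R + beta))).

(* Meaningful for t > 0: powR has the conventions 0 `^ x = (x == 0) and
   a `^ x = 1 for a < 0. *)
Definition g_ml (R : realType) (alpha t : R) : R :=
  t `^ (alpha - 1) * mittag_leffler alpha alpha (- (t `^ alpha)).

Definition tail_integral (R : realType) (K : R -> R) (x : R) : R :=
  \int[lebesgue_measure]_(y in `[x, +oo[) K y.

Definition total_mass (R : realType) (K : R -> R) : R :=
  \int[lebesgue_measure]_(y in [set: R]) K y.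

Definition phi (R : realType) (alpha : R) (K : R -> R) (c z : R) : R :=
  \int[lebesgue_measure]_(r in `]0, +oo[)
    (g_ml alpha r * tail_integral K (z + c * r)).

(* Main.v *)
Require Import Defs.
From HB Require Import structures.
From mathcomp Require Import all_boot all_order all_algebra.
From mathcomp Require Import all_classical all_reals all_analysis.
From mathcomp Require Import measurable_realfun ring lra.

Import Order.TTheory GRing.Theory Num.Theory.
Import numFieldNormedType.Exports.

(** Write k_a(t) = t^(a-1) / Gamma(a) and h_b(t) = t^(b-1) E_{alpha,b}(- t^alpha)
for t > 0, both extended by 0, and let * be convolution. The density g of the
statement is h_alpha, and S = h_1 is the relaxation function
E_{alpha,1}(- t^alpha).

Reduction. By Tonelli, phi is the integral of K against the distribution
function of g, which is 1 - S. With x = - z and K even, the mass defect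
kappa - phi becomes the integral of K(y) T((x - y) / c) over the line, where
T = S on the positive half-line and T = 1 elsewhere ([mass_sub_phi]). As x tends
to +oo this integral splits into three zones ([mass_sub_phi_split]).
 - For y >= x it is the tail of K, equivalent to C_alg x^(1-beta) / (beta - 1).
 - For y < x / 2 the factor T((x - y) / c) is equivalent to
   (c / x)^alpha / Gamma(1 - alpha), uniformly enough for dominated convergence,
   and the zone contributes kappa c^alpha x^(-alpha) / Gamma(1 - alpha).
 - For x / 2 <= y < x both factors are small, and the zone is
   O(x^(1-alpha-beta)), negligible against both previous ones since
   alpha > 0 and beta > 1.
The three cases of the theorem compare beta - 1 with alpha.

Decay of S. All that is needed is S(t) ~ t^(-alpha) / Gamma(1 - alpha), and it
follows from convolution identities alone. The k_a form a convolution semigroup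
because of the Beta integral, and h_b is the alternating series of the
k_(alpha n + b). Hence k_a * h_b = h_(a+b) and h_(alpha+b) = k_b - h_b, that is
  k_alpha * g = k_alpha - g,   k_1 * g = 1 - S,   k_(1-alpha) * g = S,
  k_alpha * S = 1 - S,         k_(2-alpha) * g = k_1 * S = h_2.
The first identity and the log-convexity of k_alpha exclude a first zero of g,
so that g > 0 ([ml_kernel_gt0]). Then S is nonnegative and nonincreasing and
S = O(t^(-alpha)), so g has total mass 1. Since k_(2-alpha)(t - s) is close to
k_(2-alpha)(t) for s small against t, h_2(t) ~ t^(1-alpha) / Gamma(2 - alpha);
h_2 is the primitive of the monotone S, and the equivalent may be
differentiated ([relax_asymptotic]). *)

Set Implicit Arguments.
Unset Strict Implicit.

Local Open Scope classical_set_scope.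
Local Open Scope ring_scope.

(** * Integrals of nonnegative functions on the line *)
Section affine.
Context {R : realType}.
Local Notation mu := (@lebesgue_measure R).
Local Open Scope ereal_scope.

Lemma measurable_affine (a b : R) :
  measurable_fun setT (fun x : measurableTypeR R => (a * x + b)%R : measurableTypeR R).
Proof. by apply: measurable_funD => //; exact: measurable_funM. Qed.

(** Half-open intervals determine the Lebesgue measure, so it suffices to compare
lengths. *)
Lemma lebesgue_measure_affine (a b : R) (A : set R) : (0 < a)%R -> measurable A ->
  mu A = a%:E * mu ((fun x => a * x + b)%R @^-1` A).
Proof.
move=> a0 mA.
pose f (x : measurableTypeR R) : measurableTypeR R := (a * x + b)%R.
pose m : {measure set (measurableTypeR R) -> \bar R} :=
  mscale (NngNum (ltW a0)) (pushforward mu f).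
rewrite (lebesgue_measure_unique (mu := m (measurable_affine a b)))//.
move=> _ [[x y]] _ <-.
rewrite -[RHS]/(a%:E * mu (f @^-1` `]x, y]%classic)).
have -> : f @^-1` `]x, y]%classic = `]((x - b) / a)%R, ((y - b) / a)%R]%classic.
  apply/seteqP; split => z /=; rewrite !in_itv/=;
  by rewrite ltr_pdivrMr// ler_pdivlMr// ltrBlDr lerBrDr (mulrC z).
rewrite !lebesgue_measure_itv/= !lte_fin ltr_pM2r ?invr_gt0// ltrD2r.
case: ifPn => _; last by rewrite mule0.
by rewrite -!EFinD -EFinM; congr EFin; field; rewrite gt_eqF.
Qed.

Lemma ge0_integral_affine (a b : R) (f : R -> \bar R) : (0 < a)%R ->
  measurable_fun setT f -> (forall x, 0 <= f x) ->
  \int[mu]_x f x = a%:E * \int[mu]_x f (a * x + b)%R.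
Proof.
move=> a0 mf f0.
pose g (x : measurableTypeR R) : measurableTypeR R := (a * x + b)%R.
have mg : measurable_fun setT g := measurable_affine a b.
pose p : {measure set (measurableTypeR R) -> \bar R} := pushforward mu g.
pose m := mscale (NngNum (ltW a0)) (p mg).
rewrite (eq_measure_integral m); last first.
  by move=> A mA _; exact: lebesgue_measure_affine.
by rewrite ge0_integral_mscale//= ge0_integral_pushforward.
Qed.

Lemma ge0_integral_opp (f : R -> \bar R) :
  measurable_fun setT f -> (forall x, 0 <= f x) ->
  \int[mu]_x f x = \int[mu]_x f (- x)%R.
Proof.
move=> mf f0.
pose g (x : measurableTypeR R) : measurableTypeR R := (- x)%R.
have mg : measurable_fun setT g by exact: measurable_funN.
pose p : {measure set (measurableTypeR R) -> \bar R} := pushforward mu g.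
rewrite (eq_measure_integral (p mg)); last first.
  by move=> A mA _; exact/esym/lebesgue_measureN.
by rewrite ge0_integral_pushforward.
Qed.

Lemma ge0_integral_shift (b : R) (f : R -> \bar R) :
  measurable_fun setT f -> (forall x, 0 <= f x) ->
  \int[mu]_x f (x - b)%R = \int[mu]_x f x.
Proof.
move=> mf f0; rewrite [RHS](ge0_integral_affine (- b) ltr01)// mul1e.
by under [RHS]eq_integral do rewrite mul1r.
Qed.

Lemma ge0_integral_reflect (b : R) (f : R -> \bar R) :
  measurable_fun setT f -> (forall x, 0 <= f x) ->
  \int[mu]_x f (b - x)%R = \int[mu]_x f x.
Proof.
move=> mf f0; rewrite [RHS]ge0_integral_opp//.
rewrite -(ge0_integral_shift b (f := fun x => f (- x)%R))//; last first.
  by apply: (measurableT_comp mf); exact: measurable_funN.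
by under [RHS]eq_integral do rewrite opprB.
Qed.

Lemma ge0_Tonelli (f : R -> R -> \bar R) :
  measurable_fun setT (fun z : R * R => f z.1 z.2) ->
  (forall x y, 0 <= f x y) ->
  \int[mu]_x \int[mu]_y f x y = \int[mu]_y \int[mu]_x f x y.
Proof.
move=> mf f0; exact: (fubini_tonelli (m1 := mu) (m2 := mu) (fun z => f z.1 z.2)).
Qed.

Lemma ge0_integralZE (c : R) (f : R -> R) : (0 <= c)%R ->
  measurable_fun setT f -> (forall x, (0 <= f x)%R) ->
  \int[mu]_x (c * f x)%:E = c%:E * \int[mu]_x (f x)%:E.
Proof.
move=> c0 mf f0.
rewrite -ge0_integralZl_EFin//; first by move=> x _; rewrite lee_fin.
exact/measurable_EFinP.
Qed.

Lemma ge0_integralZrE (c : \bar R) (f : R -> R) : 0 <= c ->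
  measurable_fun setT f -> (forall x, (0 <= f x)%R) ->
  \int[mu]_x ((f x)%:E * c) = (\int[mu]_x (f x)%:E) * c.
Proof.
move=> c0 mf f0; apply: (@ge0_integralZr _ _ _ mu _ _ (EFin \o f)) => //.
  exact/measurable_EFinP.
by move=> x _; rewrite lee_fin.
Qed.

Lemma ge0_le_integralE (F G : R -> R) :
  measurable_fun setT F -> measurable_fun setT G ->
  (forall x, (0 <= F x)%R) -> (forall x, (F x <= G x)%R) ->
  \int[mu]_x (F x)%:E <= \int[mu]_x (G x)%:E.
Proof.
move=> mF mG F0 FG; apply: ge0_le_integral => //.
- by move=> x _; rewrite lee_fin.
- exact/measurable_EFinP.
- exact/measurable_EFinP.
- by move=> x _; rewrite lee_fin.
Qed.

Lemma ge0_integralDE (F G : R -> R) :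
  measurable_fun setT F -> measurable_fun setT G ->
  (forall x, (0 <= F x)%R) -> (forall x, (0 <= G x)%R) ->
  \int[mu]_x (F x + G x)%:E = \int[mu]_x (F x)%:E + \int[mu]_x (G x)%:E.
Proof.
move=> mF mG F0 G0; rewrite -ge0_integralD//.
- by move=> x _; rewrite lee_fin.
- exact/measurable_EFinP.
- by move=> x _; rewrite lee_fin.
- exact/measurable_EFinP.
Qed.

End affine.

(** * Powers and their integrals *)
Section powers.
Context {R : realType}.

(** Extending the power by 0 makes convolution on the half-line an integral over
the whole line, where translations and Tonelli need no change of domain. *)
Definition pospow (a x : R) : R := if 0 < x then x `^ (a - 1) else 0.

Lemma pospow_ge0 a x : 0 <= pospow a x.
Proof. by rewrite /pospow; case: ifP => // _; exact: powR_ge0. Qed.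

Lemma measurable_pospow a : measurable_fun setT (pospow a).
Proof.
apply: measurable_fun_ifT => //; first exact: measurable_fun_ltr.
Qed.

Lemma pospowM a t x : 0 < t -> pospow a (t * x) = t `^ (a - 1) * pospow a x.
Proof.
move=> t0; rewrite /pospow pmulr_rgt0//; case: ifPn => x0; last by rewrite mulr0.
by rewrite powRM// ltW.
Qed.

End powers.

Section power_integrals.
Context {R : realType}.
Local Notation mu := (@lebesgue_measure R).

Lemma continuous_powR_gt0 (p x : R) : 0 < x -> {for x, continuous ((@powR R) ^~ p)}.
Proof.
move=> x0; apply: differentiable_continuous; apply/derivable1_diffP.
by apply: derivable_powR; rewrite in_itv/= x0.
Qed.

Lemma is_derive_powR_div (p x : R) : p != 0 -> 0 < x ->
  is_derive x 1 (fun y => y `^ p / p) (x `^ (p - 1)).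
Proof.
move=> p0 x0.
have -> : x `^ (p - 1) = p^-1 *: (p * x `^ (p - 1)).
  by rewrite /GRing.scale/= mulKf.
have -> : (fun y : R => y `^ p / p) = p^-1 \*: ((@powR R) ^~ p).
  by apply/funext => y /=; rewrite /GRing.scale/= mulrC.
by apply: is_deriveZ; exact: is_derive1_powR.
Qed.

Lemma cvgr_powRN (p : R) : 0 < p -> x `^ (- p) @[x --> +oo] --> (0 : R).
Proof.
move=> p0; apply/cvgrPdist_lt => e e0; near=> x.
rewrite sub0r normrN ger0_norm ?powR_ge0// powRN.
have x0 : 0 < x by near: x; exact: nbhs_pinfty_gt.
rewrite invf_plt ?posrE ?powR_gt0//.
have -> : e^-1 = (e^-1 `^ p^-1) `^ p.
  by rewrite -powRrM mulVf ?gt_eqF// powRr1// invr_ge0 ltW.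
by rewrite gt0_ltr_powR ?nnegrE ?powR_ge0 ?(ltW x0)//.
Unshelve. all: by end_near. Qed.

Lemma integral_powR_segment (p a b : R) : p != 0 -> 0 < a -> a < b ->
  (\int[mu]_(x in `[a, b]) (x `^ (p - 1))%:E = (b `^ p / p - a `^ p / p)%:E)%E.
Proof.
move=> p0 a0 ab.
rewrite EFinB; apply: (@continuous_FTC2 _ _ (fun y => y `^ p / p)) => //.
- apply: continuous_in_subspaceT => x; rewrite inE/= in_itv/= => /andP[ax _].
  by apply: continuous_powR_gt0; exact: lt_le_trans ax.
- split.
  + move=> x; rewrite in_itv/= => /andP[ax _].
    by have [] := is_derive_powR_div p0 (lt_trans a0 ax).
  + apply: cvg_at_right_filter; apply: cvgMr_tmp.
    exact: continuous_powR_gt0.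
  + apply: cvg_at_left_filter; apply: cvgMr_tmp.
    by apply: continuous_powR_gt0; exact: lt_trans ab.
- move=> x; rewrite in_itv/= => /andP[ax _].
  have [d e] := is_derive_powR_div p0 (lt_trans a0 ax).
  by rewrite derive1E e.
Qed.

Lemma integral_powR_tail (p a : R) : 0 < p -> 0 < a ->
  (\int[mu]_(x in `[a, +oo[) (x `^ (- p - 1))%:E = (a `^ (- p) / p)%:E)%E.
Proof.
move=> p0 a0.
have pn0 : - p != 0 by rewrite oppr_eq0 gt_eqF.
rewrite (@ge0_continuous_FTC2y _ _ (fun y => y `^ (- p) / - p) _ 0)//.
- by rewrite -EFinB sub0r invrN mulrN opprK.
- by move=> x _; exact: powR_ge0.
- apply: continuous_in_subspaceT => x; rewrite inE/= in_itv/= andbT => ax.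
  by apply: continuous_powR_gt0; exact: lt_le_trans ax.
- rewrite -[X in _ --> X](mul0r (- p)^-1); apply: cvgMr_tmp.
  exact: cvgr_powRN.
- move=> x ax.
  by have [] := is_derive_powR_div pn0 (lt_trans a0 ax).
- apply: cvg_at_right_filter; apply: cvgMr_tmp.
  exact: continuous_powR_gt0.
- move=> x; rewrite in_itv/= andbT => ax.
  have [d e] := is_derive_powR_div pn0 (lt_trans a0 ax).
  by rewrite derive1E e.
Qed.

(** For p < 1 the integrand is unbounded at 0, hence the exhaustion of ]0, 1] by
segments. *)
Lemma integral_powR_01 (p : R) : 0 < p ->
  (\int[mu]_(x in `]0%R, 1%R]) (x `^ (p - 1))%:E = (p^-1)%:E)%E.
Proof.
move=> p0.
pose F (n : nat) : set R := `[n.+2%:R^-1, 1]%classic.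
have F01 : \bigcup_n F n = `]0%R, 1%R]%classic.
  apply/seteqP; split=> [x [n _]|x]; rewrite /F/= !in_itv/= => /andP[x0 x1].
    by rewrite x1 andbT (lt_le_trans _ x0)// invr_gt0.
  exists (Num.truncn x^-1) => //; rewrite /F/= in_itv/= x1 andbT.
  rewrite -[leRHS]invrK lef_pV2 ?posrE ?invr_gt0//.
  by rewrite (le_trans (ltW (truncnS_gt _)))// ler_nat.
have h : (\int[mu]_(x in F n) (x `^ (p - 1))%:E)%E @[n --> \oo] -->
   (\int[mu]_(x in \bigcup_n F n) (x `^ (p - 1))%:E)%E.
  apply: ge0_nondecreasing_set_cvg_integral => //.
  - move=> m n mn; apply/subsetPset => x; rewrite /F/= !in_itv/= => /andP[x0 ->].
    by rewrite andbT (le_trans _ x0)// lef_pV2 ?posrE// ler_nat.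
  - by move=> n; exact: measurable_itv.
  - by move=> n; apply/measurable_EFinP; apply: measurable_funTS.
  - by move=> n x _; rewrite lee_fin powR_ge0.
rewrite -F01; apply: cvg_unique h _ => //.
rewrite (_ : (fun n => _) = (fun n : nat => (p^-1 - n.+2%:R^-1 `^ p / p)%:E)).
  apply: cvg_EFin; first exact: nearW.
  rewrite -[X in _ --> X]subr0; apply: cvgB; first exact: cvg_cst.
  rewrite -[X in _ --> X](mul0r p^-1); apply: cvgMr_tmp.
  under eq_fun do rewrite -[_^-1]powR_inv1// -powRrM mulN1r.
  apply: (@cvg_comp _ _ _ (fun n : nat => n.+2%:R) (fun x : R => x `^ - p) _ +oo).
    apply/cvgryPge => A; near=> m; apply: (@le_trans _ _ m%:R).
      by near: m; exact: nbhs_infty_ger.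
    by rewrite ler_nat -addn2 leq_addr.
  exact: cvgr_powRN.
apply/funext => n; rewrite integral_powR_segment ?gt_eqF ?powR1 ?mul1r//.
by rewrite invf_lt1// ltr1n.
Unshelve. all: by end_near. Qed.

End power_integrals.

(** * Euler's integrals and the semigroup of power kernels *)
Section gamma.
Context {R : realType}.
Local Notation mu := (@lebesgue_measure R).

Definition convol (f h : R -> R) (t : R) : \bar R :=
  (\int[mu]_s (f (t - s) * h s)%:E)%E.

(** Extended-real versions of Euler's integrals: finiteness of Gamma is itself
obtained from the product formula [eGammaM], which therefore has to make sense
beforehand. *)
Definition eGamma (a : R) : \bar R :=
  (\int[mu]_x (pospow a x * expR (- x))%:E)%E.

Definition eBeta (a b : R) : \bar R := convol (pospow a) (pospow b) 1.

Lemma measurable_convol2 (f h : R -> R) :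
  measurable_fun setT f -> measurable_fun setT h ->
  measurable_fun setT (fun z : R * R => f (z.1 - z.2) * h z.2).
Proof.
move=> mf mh; apply: measurable_funM.
  by apply: (measurableT_comp mf); exact: measurable_funB.
exact: measurableT_comp.
Qed.

Lemma measurable_convol1 (f h : R -> R) (t : R) :
  measurable_fun setT f -> measurable_fun setT h ->
  measurable_fun setT (fun s : R => f (t - s) * h s).
Proof.
move=> mf mh; apply: measurable_funM => //.
by apply: (measurableT_comp mf); exact: measurable_funB.
Qed.

Lemma eGamma_ge0 a : (0 <= eGamma a)%E.
Proof.
by apply: integral_ge0 => x _; rewrite lee_fin mulr_ge0// ?pospow_ge0 ?expR_ge0.
Qed.

Lemma eBeta_ge0 a b : (0 <= eBeta a b)%E.
Proof.
by apply: integral_ge0 => x _; rewrite lee_fin mulr_ge0// pospow_ge0.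
Qed.

Lemma pospow_convol_le0 (a b t s : R) : t <= 0 ->
  pospow a (t - s) * pospow b s = 0.
Proof.
move=> t0; rewrite /pospow; case: ifPn => s1; last by rewrite mul0r.
by case: ifPn => s0; [lra|rewrite mulr0].
Qed.

(** Substitute s = t u. *)
Lemma convol_pospow a b t :
  convol (pospow a) (pospow b) t = ((pospow (a + b) t)%:E * eBeta a b)%E.
Proof.
have m u : measurable_fun setT (fun s : R => (pospow a (u - s) * pospow b s)%:E).
  by apply/measurable_EFinP; apply: measurable_convol1; exact: measurable_pospow.
have p0 u s : (0 <= (pospow a (u - s) * pospow b s)%:E)%E.
  by rewrite lee_fin mulr_ge0// pospow_ge0.
have [t0|t0] := ltP 0 t; last first.
  rewrite [pospow (a + b) t]/pospow ltNge t0/= mul0e /convol integral0_eq// => s _.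
  by rewrite pospow_convol_le0.
have := ge0_integral_affine 0 t0 (m t) (p0 t).
rewrite /eBeta /convol => ->.
pose f s := pospow a (1 - s) * pospow b s.
have -> : (\int[mu]_s (pospow a (t - (t * s + 0)) * pospow b (t * s + 0))%:E =
    \int[mu]_s (t `^ (a + b - 2) * f s)%:E)%E.
  apply: eq_integral => s _; congr EFin.
  rewrite addr0 (_ : t - t * s = t * (1 - s)); last by rewrite mulrBr mulr1.
  rewrite !pospowM// (_ : a + b - 2 = (a - 1) + (b - 1)); last by ring.
  by rewrite (@powRD _ t (a - 1)) ?(gt_eqF t0) ?implybT//; exact: mulrACA.
rewrite ge0_integralZE ?powR_ge0//.
- rewrite muleA -EFinM; congr (_%:E * _)%E.
  rewrite /pospow t0 (_ : a + b - 1 = 1 + (a + b - 2)); last by ring.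
  by rewrite (@powRD _ t 1) ?(gt_eqF t0) ?implybT// powRr1// ltW.
- by apply: measurable_convol1; exact: measurable_pospow.
- by move=> s; rewrite mulr_ge0// pospow_ge0.
Qed.

(** The integral of exp(- t) times the convolution of two powers, computed in both
orders. *)
Lemma eGammaM a b : (eGamma a * eGamma b = eBeta a b * eGamma (a + b))%E.
Proof.
pose f t s := (expR (- t) * (pospow a (t - s) * pospow b s))%:E.
have f0 t s : (0 <= f t s)%E.
  by rewrite lee_fin mulr_ge0 ?expR_ge0// mulr_ge0// pospow_ge0.
have mf : measurable_fun setT (fun z : R * R => f z.1 z.2).
  apply/measurable_EFinP; apply: measurable_funM.
    apply: measurableT_comp => //; exact: measurable_funN.
  by apply: measurable_convol2; exact: measurable_pospow.
have mG c : measurable_fun setT (fun x : R => (pospow c x * expR (- x))%:E).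
  apply/measurable_EFinP; apply: measurable_funM; first exact: measurable_pospow.
  by apply: measurableT_comp => //; exact: measurable_funN.
have G0 (c x : R) : (0 <= (pospow c x * expR (- x))%:E)%E.
  by rewrite lee_fin mulr_ge0 ?pospow_ge0// expR_ge0.
have inner_t s : (\int[mu]_t f t s = (pospow b s * expR (- s))%:E * eGamma a)%E.
  rewrite -[eGamma a](ge0_integral_shift s (mG a) (G0 a)).
  have := @ge0_integralZE R (pospow b s * expR (- s))
    (fun t => pospow a (t - s) * expR (- (t - s))).
  move=> <-.
  - apply: eq_integral => t _; congr EFin.
    have -> : - (t : R) = - (t - s) + - s by ring.
    by rewrite expRD; ring.
  - by rewrite mulr_ge0 ?pospow_ge0 ?expR_ge0.
  - apply/measurable_EFinP; apply: (measurableT_comp (mG a)).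
    exact: measurable_funB.
  - by move=> t; rewrite mulr_ge0 ?pospow_ge0 ?expR_ge0.
have inner_s t : (\int[mu]_s f t s = (pospow (a + b) t * expR (- t))%:E * eBeta a b)%E.
  rewrite mulrC EFinM -muleA -convol_pospow /convol -ge0_integralZE ?expR_ge0//.
  - by apply: measurable_convol1; exact: measurable_pospow.
  - by move=> s; rewrite mulr_ge0// pospow_ge0.
have mP c : measurable_fun setT (fun x : R => pospow c x * expR (- x)).
  by apply/measurable_EFinP; exact: mG.
have P0 (c x : R) : 0 <= pospow c x * expR (- x) by rewrite -lee_fin G0.
rewrite muleC [RHS]muleC.
apply: etrans (esym (ge0_integralZrE (eGamma_ge0 a) (mP b) (P0 b))) _.
apply: etrans _ (ge0_integralZrE (eBeta_ge0 a b) (mP (a + b)) (P0 (a + b))).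
transitivity (\int[mu]_s \int[mu]_t f t s)%E.
  by apply: eq_integral => s _; exact/esym.
by rewrite -ge0_Tonelli//; apply: eq_integral.
Qed.

(** Restrict the integral to [M, M + 1]. The point M is free: large M will give
the superexponential growth of Gamma. *)
Lemma eGamma_ge a M : 0 < a -> 0 < M ->
  ((M `^ a * expR (- (M + 1)) / (M + 1))%:E <= eGamma a)%E.
Proof.
move=> a0 M0.
set c := _ / _.
have -> : (c%:E = \int[mu]_(x in `[M, (M + 1)%R]) c%:E)%E.
  rewrite integral_cst//= lebesgue_measure_itv/= lte_fin ltrDl ltr01.
  by rewrite -EFinB addrAC subrr add0r mule1.
rewrite integral_mkcond; apply: ge0_le_integral => //.
- move=> x _; rewrite patchE; case: ifPn => // _; rewrite lee_fin.
  by rewrite divr_ge0// ?mulr_ge0// ?powR_ge0 ?expR_ge0// addr_ge0// ltW.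
- by apply/(measurable_restrictT _ _).1.
- apply/measurable_EFinP; apply: measurable_funM; first exact: measurable_pospow.
  by apply: measurableT_comp => //; exact: measurable_funN.
- move=> x _; rewrite patchE; case: ifPn; last first.
    by move=> _; rewrite lee_fin mulr_ge0 ?pospow_ge0 ?expR_ge0.
  rewrite inE/= in_itv/= => /andP[Mx xM]; rewrite lee_fin /c.
  have x0 : 0 < x := lt_le_trans M0 Mx.
  rewrite /pospow x0 powRB ?(gt_eqF x0) ?implybT// powRr1 ?(ltW x0)// mulrAC.
  apply: ler_pM.
  + by rewrite divr_ge0 ?powR_ge0// addr_ge0// ltW.
  + exact: expR_ge0.
  + apply: ler_pM => //; rewrite ?powR_ge0 ?invr_ge0 ?addr_ge0 ?(ltW M0)//.
      by rewrite ge0_ler_powR// ?nnegrE ?(ltW M0) ?(ltW x0) ?(ltW a0).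
    by rewrite lef_pV2// posrE addr_gt0.
  + by rewrite ler_expR lerN2.
Qed.

Lemma eGamma1 : eGamma 1 = 1%E.
Proof.
rewrite -(integral_exponential_pdf (R := R) ltr01).
rewrite (_ : exponential_pdf 1 = (fun x : R => expR (- x)) \_ `[0, +oo[); last first.
  apply/funext => x; rewrite /exponential_pdf !patchE; case: ifP => // _.
  by rewrite mul1r mulN1r.
transitivity (\int[mu]_(x in `[0%R, +oo[) (expR (- x))%:E)%E; last first.
  by rewrite integral_mkcond; apply: eq_integral => x _; rewrite !patchE; case: ifP.
rewrite -integral_itv_obnd_cbnd; last first.
  apply/measurable_EFinP; apply: measurableT_comp => //; exact: measurable_funN.
rewrite integral_mkcond; apply: eq_integral => x _.
rewrite patchE mem_setE in_itv/= andbT /pospow; case: ifP => x0.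
  by rewrite subrr powRr0 mul1r.
by rewrite mul0r.
Qed.

Lemma eBeta1 a : 0 < a -> eBeta 1 a = (a^-1)%:E.
Proof.
move=> a0; rewrite -(integral_powR_01 a0).
rewrite -integral_itv_bndo_bndc; last first.
  by apply/measurable_EFinP; apply: measurable_funTS.
rewrite integral_mkcond; apply: eq_integral => x _.
rewrite patchE mem_setE in_itv/= /pospow subr_gt0.
case: (ltP x 1) => x1; last by rewrite mul0r andbF.
by rewrite andbT subrr powRr0 mul1r; case: ifP.
Qed.

(** The case b = 1 of [eGammaM], where the Beta integral is elementary. *)
Lemma eGammaD1 a : 0 < a -> eGamma a = ((a^-1)%:E * eGamma (1 + a))%E.
Proof. by move=> a0; rewrite -eBeta1// -eGammaM eGamma1 mul1e. Qed.

Lemma eGamma_nat_lty n : (eGamma n.+1%:R < +oo)%E.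
Proof.
elim: n => [|n ih]; first by rewrite eGamma1 ltry.
have n0 : (0 : R) < n.+1%:R by [].
move: ih; rewrite (eGammaD1 n0) nat1r; 
case: (eGamma _) (eGamma_ge0 n.+2%:R) => [r _ _|_|//]; first by rewrite ltry.
by rewrite mulry gtr0_sg ?invr_gt0// mul1e ltxx.
Qed.

(** By the functional equation it suffices to bound the integral at 1 + a, where
x^a <= 1 + x^(n+1) for n + 1 >= a compares it with two factorials. *)
Lemma eGamma_lty (a : R) : 0 < a -> (eGamma a < +oo)%E.
Proof.
move=> a0; pose n := Num.truncn a.
have an : a <= n.+1%:R := ltW (truncnS_gt a).
have mP c : measurable_fun setT (fun x : R => (pospow c x * expR (- x))%:E).
  apply/measurable_EFinP; apply: measurable_funM; first exact: measurable_pospow.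
  by apply: measurableT_comp => //; exact: measurable_funN.
have P0 (c x : R) : (0 <= (pospow c x * expR (- x))%:E)%E.
  by rewrite lee_fin mulr_ge0 ?pospow_ge0// expR_ge0.
have : (eGamma (1 + a) < +oo)%E.
  apply: (@le_lt_trans _ _ (eGamma 1 + eGamma n.+2%:R)%E); last first.
    by rewrite lte_add_pinfty// ?eGamma1 ?ltry// eGamma_nat_lty.
  rewrite /eGamma -ge0_integralD//; do ?[exact: mP].
  apply: ge0_le_integral => //; do ?[exact: mP].
    exact: emeasurable_funD (mP _) (mP _).
  move=> x _; rewrite -EFinD lee_fin -mulrDl ler_wpM2r ?expR_ge0//.
  rewrite /pospow; case: ifPn => x0; last by rewrite addr0.
  rewrite subrr powRr0 addrAC subrr add0r -nat1r addrAC subrr add0r.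
  have [x1|x1] := leP x 1.
    rewrite -[leLHS]addr0 lerD ?powR_ge0//.
    have -> : 1 = 1 `^ a :> R by rewrite powR1.
    by rewrite ge0_ler_powR// ?nnegrE ?(ltW x0) ?(ltW a0).
  rewrite -[leLHS]add0r lerD//; apply: ler_powR => //; exact: ltW.
rewrite (eGammaD1 a0); case: (eGamma _) (eGamma_ge0 (1 + a)) => [r _ _| |]//.
by rewrite -EFinM ltry.
Qed.

Lemma EFin_Gamma (a : R) : 0 < a -> (Gamma a)%:E = eGamma a.
Proof.
move=> a0; rewrite /Gamma /Rintegral.
have -> : (\int[mu]_(x in `]0%R, +oo[) (x `^ (a - 1) * expR (- x))%:E = eGamma a)%E.
  rewrite integral_mkcond; apply: eq_integral => x _.
  rewrite patchE mem_setE in_itv/= andbT /pospow; case: ifP => // _.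
  by rewrite mul0r.
by rewrite fineK// ge0_fin_numE ?eGamma_ge0// eGamma_lty.
Qed.

Lemma Gamma_ge (a M : R) : 0 < a -> 0 < M ->
  M `^ a * expR (- (M + 1)) / (M + 1) <= Gamma a.
Proof. by move=> a0 M0; rewrite -lee_fin EFin_Gamma// eGamma_ge. Qed.

Lemma Gamma_gt0 (a : R) : 0 < a -> 0 < Gamma a.
Proof.
move=> a0; apply: lt_le_trans (Gamma_ge a0 ltr01).
by rewrite divr_gt0// mulr_gt0 ?powR_gt0 ?expR_gt0.
Qed.

Lemma GammaD1 (a : R) : 0 < a -> Gamma (1 + a) = a * Gamma a.
Proof.
move=> a0; apply: EFin_inj; rewrite EFinM !EFin_Gamma ?addr_gt0//.
by rewrite (eGammaD1 a0) muleA -EFinM divff ?gt_eqF// mul1e.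
Qed.

Lemma eBetaE (a b : R) : 0 < a -> 0 < b ->
  eBeta a b = (Gamma a * Gamma b / Gamma (a + b))%:E.
Proof.
move=> a0 b0; have ab0 : 0 < a + b by rewrite addr_gt0.
have g := Gamma_gt0 ab0.
rewrite !EFinM !EFin_Gamma// eGammaM -EFin_Gamma// -muleA -EFinM.
by rewrite divff ?mule1// gt_eqF.
Qed.

(** The kernel of the Riemann-Liouville fractional integral of order a. *)
Definition rl_kernel (a x : R) : R := pospow a x / Gamma a.

Lemma rl_kernel_ge0 (a x : R) : 0 < a -> 0 <= rl_kernel a x.
Proof. by move=> a0; rewrite divr_ge0 ?pospow_ge0// ltW// Gamma_gt0. Qed.

Lemma measurable_rl_kernel a : measurable_fun setT (rl_kernel a).
Proof. by apply: measurable_funM => //; exact: measurable_pospow. Qed.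

Lemma convol_rl_kernel (a b t : R) : 0 < a -> 0 < b ->
  convol (rl_kernel a) (rl_kernel b) t = (rl_kernel (a + b) t)%:E.
Proof.
move=> a0 b0.
have : convol (pospow a) (pospow b) t =
    ((pospow (a + b) t) * (Gamma a * Gamma b / Gamma (a + b)))%:E.
  by rewrite convol_pospow eBetaE.
rewrite /rl_kernel; move: (Gamma_gt0 a0) (Gamma_gt0 b0) (Gamma_gt0 (addr_gt0 a0 b0)).
move: (Gamma a) (Gamma b) (Gamma (a + b)) => ga gb gab ga0 gb0 gab0 h.
have gM0 : 0 <= (ga * gb)^-1 by rewrite invr_ge0 ltW// mulr_gt0.
transitivity ((ga * gb)^-1%:E * convol (pospow a) (pospow b) t)%E.
  rewrite /convol -ge0_integralZE//.
  - by apply: eq_integral => s _; congr EFin; rewrite invfM mulrACA mulrC.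
  - by apply: measurable_convol1; exact: measurable_pospow.
  - by move=> s; rewrite mulr_ge0// pospow_ge0.
rewrite h -EFinM; congr EFin; field.
by rewrite !gt_eqF.
Qed.

(** With b = 1 the second factor is the indicator of s > v, and the integral is
that of the kernel over an interval. *)
Lemma convol_rl_kernel_shift (a b u v : R) : 0 < a -> 0 < b ->
  (\int[mu]_s (rl_kernel a (u - s) * rl_kernel b (s - v))%:E =
   (rl_kernel (a + b) (u - v))%:E)%E.
Proof.
move=> a0 b0; rewrite -(convol_rl_kernel (u - v) a0 b0) /convol.
rewrite -(@ge0_integral_shift _ v
  (fun s : R => (rl_kernel a (u - v - s) * rl_kernel b s)%:E)).
- apply: eq_integral => s _; congr (rl_kernel a _ * _)%:E.
  by rewrite opprB addrA subrK.
- by apply/measurable_EFinP; apply: measurable_convol1; exact: measurable_rl_kernel.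
- by move=> s; rewrite lee_fin; exact: mulr_ge0 (rl_kernel_ge0 _ a0) (rl_kernel_ge0 _ b0).
Qed.

End gamma.

(** * Mittag-Leffler kernels *)
Section entire.
Context {R : realType}.

(** The coefficient sequences of entire functions, in a form stable under termwise
differentiation. *)
Definition fast_decay (c : nat -> R) :=
  forall rho : R, 0 < rho -> exists C : R, forall n, `|c n| <= C * rho ^+ n.

Lemma fast_decay_diffs c : fast_decay c -> fast_decay (pseries_diffs c).
Proof.
move=> fc rho rho0; have [|C hC] := fc (rho / 2); first by rewrite divr_gt0.
(* the factor n + 1 is absorbed by 2 ^ (n + 1), whence the rate rho / 2 *)
exists (C * (rho / 2) * 2) => n.
rewrite /pseries_diffs normrM ger0_norm//.
have C0 : 0 <= C by have := hC 0%N; rewrite expr0 mulr1; exact: le_trans.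
have n2 : n.+1%:R <= 2 ^+ n.+1 :> R.
  by rewrite -natrX ler_nat ltnW// ltn_expl.
have -> : C * (rho / 2) * 2 * rho ^+ n = 2 ^+ n.+1 * (C * (rho / 2) ^+ n.+1).
  by rewrite [RHS]mulrCA -exprMn (mulrCA 2) divff// mulr1 exprS; field.
by apply: ler_pM.
Qed.

Lemma fast_decay_cvg c K : fast_decay c -> cvgn (pseries c K).
Proof.
move=> fc; pose rho := (2 * (`|K| + 1))^-1.
have K1 : 0 < `|K| + 1 by rewrite ltr_wpDl.
have rho0 : 0 < rho by rewrite invr_gt0 mulr_gt0.
have [C hC] := fc _ rho0.
have C0 : 0 <= C by have := hC 0%N; rewrite expr0 mulr1; exact: le_trans.
apply: normed_cvg.
apply: (@series_le_cvg _ _ (geometric C (rho * `|K|))) => //.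
- by move=> n /=.
- by move=> n /=; rewrite mulr_ge0// exprn_ge0// mulr_ge0// ltW.
- by move=> n /=; rewrite normrM normrX exprMn mulrA ler_wpM2r// exprn_ge0.
- apply: is_cvg_geometric_series; rewrite ger0_norm ?mulr_ge0// ?(ltW rho0)//.
  by rewrite /rho mulrC ltr_pdivrMr ?mulr_gt0// mul1r; lra.
Qed.

Lemma fast_decay_continuous c : fast_decay c ->
  continuous (fun x => limn (pseries c x)).
Proof.
move=> fc x.
have h := fast_decay_diffs fc.
have [] := @pseries_snd_diffs R c (`|x| + 1) x (fast_decay_cvg fc)
  (fast_decay_cvg h) (fast_decay_cvg (fast_decay_diffs h)).
  by rewrite [ltRHS]ger0_norm ?addr_ge0// ltrDl.
by move=> /derivable1_diffP/differentiable_continuous.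
Qed.

End entire.

Section series_integral.
Context {R : realType}.
Local Notation mu := (@lebesgue_measure R).

(** Termwise integration of a signed series: the partial sums are dominated by the
sum of the absolute values, which is integrable by monotone convergence. *)
Lemma integral_dominated_series (u : nat -> R -> R) (U : R -> R) :
  (forall n, measurable_fun setT (u n)) ->
  (forall x, series (u ^~ x) @ \oo --> U x) ->
  (forall x, cvgn [normed series (u ^~ x)]) ->
  (\sum_(n <oo) \int[mu]_x (`|u n x|)%:E < +oo)%E ->
  (fun n => (\sum_(0 <= i < n) \int[mu]_x (u i x)%:E)%E) @ \oo -->
    (\int[mu]_x (U x)%:E)%E.
Proof.
move=> mu_ uU cu su.
pose g x : R := limn [normed series (u ^~ x)].
have nu n : measurable_fun setT (fun x => (`|u n x|)%:E).
  by apply/measurable_EFinP; exact: measurableT_comp.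
have gE x : (g x)%:E = (\sum_(n <oo) (`|u n x|)%:E)%E.
  rewrite /g -EFin_lim//; congr (limn _); apply/funext => n /=.
  by rewrite /series/= sumEFin.
have mg : measurable_fun setT g.
  apply: (@measurable_fun_cvg _ _ _ _ (fun n x => [normed series (u ^~ x)] n)) => //.
  move=> n; rewrite /series/=; apply: measurable_sum => i.
  exact: measurableT_comp.
have ig : mu.-integrable setT (EFin \o g).
  apply/integrableP; split; first exact/measurable_EFinP.
  apply: le_lt_trans su.
  rewrite -integral_nneseries//.
  apply: ge0_le_integral => //.
  - by apply: measurableT_comp => //; exact/measurable_EFinP.
  - under eq_fun do rewrite -gE; exact/measurable_EFinP.
  - move=> x _; rewrite -gE /= lee_fin ger0_norm//.
    by rewrite -lee_fin gE; apply: nneseries_ge0 => *; rewrite lee_fin.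
have sm n : measurable_fun setT (fun x => (series (u ^~ x) n)%:E).
  by apply/measurable_EFinP; rewrite /series/=; exact: measurable_sum.
have iu n : mu.-integrable setT (EFin \o u n).
  apply: (le_integrable _ _ _ ig) => //.
    by apply/measurable_EFinP; exact: mu_.
  move=> x _ /=; rewrite lee_fin; apply: le_trans (ler_norm _).
  apply: (@le_trans _ _ ([normed series (u ^~ x)] n.+1)).
    rewrite -[leRHS]/(\sum_(0 <= i < n.+1) `|u i x|).
    by rewrite big_nat_recr//= lerDr sumr_ge0.
  by apply: nondecreasing_cvgn_le (cu x) _; apply: nondecreasing_series => * /=.
have := @dominated_convergence _ _ _ mu setT measurableT
  (fun n x => (series (u ^~ x) n)%:E) (EFin \o U) (EFin \o g) sm.
case => //.
- apply/measurable_EFinP.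
  apply: (@measurable_fun_cvg _ _ _ _ (fun n x => series (u ^~ x) n)) => //.
  by move=> n; apply/measurable_EFinP; exact: sm.
- by apply: aeW => x _; apply: cvg_EFin; [exact: nearW|exact: uU].
- apply: aeW => x n _ /=; rewrite lee_fin.
  apply: (@le_trans _ _ ([normed series (u ^~ x)] n)); first exact: ler_norm_sum.
  by apply: nondecreasing_cvgn_le (cu x) _; apply: nondecreasing_series => * /=.
move=> _ _ h; apply: cvg_trans h.
rewrite (_ : (fun n => _) = (fun n => (\int[mu]_x (series (u ^~ x) n)%:E)%E))//.
apply/funext => n; rewrite -integral_sum//.
by apply: eq_integral => x _; rewrite /series/= sumEFin.
Qed.

End series_integral.

Section mittag_leffler.
Context {R : realType}.
Local Notation mu := (@lebesgue_measure R).
Variable alpha : R.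
Hypothesis alpha0 : 0 < alpha.

Lemma ml_argument_gt0 (b : R) n : 0 < b -> 0 < alpha * n%:R + b.
Proof. by move=> b0; rewrite ltr_wpDl// mulr_ge0// ltW. Qed.

Lemma fast_decay_Gamma (b : R) : 0 < b ->
  fast_decay (fun n => (Gamma (alpha * n%:R + b))^-1).
Proof.
(* M is such that M ^ (- alpha) = rho *)
move=> b0 rho rho0; pose M := rho `^ (- alpha^-1).
have M0 : 0 < M by rewrite powR_gt0.
have M1 : 0 < M + 1 by rewrite addr_gt0.
exists ((M + 1) / (expR (- (M + 1)) * M `^ b)) => n.
have g0 := Gamma_gt0 (ml_argument_gt0 n b0).
rewrite ger0_norm ?invr_ge0 ?(ltW g0)//.
have hG := Gamma_ge (ml_argument_gt0 n b0) M0.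
have -> : (M + 1) / (expR (- (M + 1)) * M `^ b) * rho ^+ n =
  (M `^ (alpha * n%:R + b) * expR (- (M + 1)) / (M + 1))^-1.
  have -> : rho ^+ n = (M `^ (alpha * n%:R))^-1.
    rewrite -powRN /M -powRrM (_ : _ * _ = n%:R) ?powR_mulrn ?(ltW rho0)//.
    by field; rewrite gt_eqF.
  rewrite powRD ?(gt_eqF M0) ?implybT//.
  have := powR_gt0 (alpha * n%:R) M0; have := powR_gt0 b M0.
  have := expR_gt0 (- (M + 1)).
  move: (expR _) (M `^ b) (M `^ (_ * _)) => x y z x0 y0 z0.
  by field; rewrite !gt_eqF.
rewrite lef_pV2 ?posrE//.
by rewrite divr_gt0// mulr_gt0 ?expR_gt0// powR_gt0.
Qed.

Let mlE (b z : R) : mittag_leffler alpha b z =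
  limn (pseries (fun n => (Gamma (alpha * n%:R + b))^-1) z).
Proof.
rewrite /mittag_leffler /pseries; congr (limn (series _)).
by apply/funext => n /=; rewrite mulrC.
Qed.

Lemma continuous_mittag_leffler (b : R) : 0 < b ->
  continuous (mittag_leffler alpha b).
Proof.
move=> b0; rewrite (_ : mittag_leffler alpha b =
  (fun z => limn (pseries (fun n => (Gamma (alpha * n%:R + b))^-1) z))).
  exact/fast_decay_continuous/fast_decay_Gamma.
by apply/funext => z; exact: mlE.
Qed.

Lemma cvg_mittag_leffler (b z : R) : 0 < b ->
  series (fun n => z ^+ n / Gamma (alpha * n%:R + b)) @ \oo -->
    mittag_leffler alpha b z.
Proof.
move=> b0; rewrite mlE.
rewrite (_ : (fun n => z ^+ n / _) =
    (fun n => (Gamma (alpha * n%:R + b))^-1 * z ^+ n)).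
  exact: (fast_decay_cvg (K := z) (fast_decay_Gamma b0)).
by apply/funext => n; rewrite mulrC.
Qed.

Lemma mittag_leffler0 (b : R) : 0 < b -> mittag_leffler alpha b 0 = (Gamma b)^-1.
Proof.
move=> b0; apply/cvg_lim => //; rewrite -(cvg_shiftn 1)/=.
apply: cvg_near_cst; apply: nearW => n /=.
rewrite /series/= addn1 big_nat_recl//= big1 ?addr0 ?expr0 ?mulr0 ?add0r ?mul1r//.
by move=> i _; rewrite expr0n mul0r.
Qed.

(** For b = alpha this is the density g, for b = 1 the relaxation function and for
b = 2 its primitive. *)
Definition ml_kernel (b t : R) : R :=
  if 0 < t then t `^ (b - 1) * mittag_leffler alpha b (- (t `^ alpha)) else 0.

Lemma rl_kernelE (b t : R) n : 0 < t -> rl_kernel (alpha * n%:R + b) t =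
  t `^ (b - 1) * ((t `^ alpha) ^+ n / Gamma (alpha * n%:R + b)).
Proof.
move=> t0; rewrite /rl_kernel /pospow t0 mulrA; congr (_ / _).
rewrite -powR_mulrn ?powR_ge0// -powRrM -powRD ?(gt_eqF t0) ?implybT//.
by congr (_ `^ _); ring.
Qed.

(** The expansion that makes every convolution identity below a consequence of the
semigroup law of the power kernels. *)
Lemma cvg_ml_kernel_series (b t : R) : 0 < b ->
  series (fun n => (- 1) ^+ n * rl_kernel (alpha * n%:R + b) t) @ \oo --> ml_kernel b t.
Proof.
move=> b0; rewrite /ml_kernel; case: ifPn => t0; last first.
  apply: cvg_near_cst; apply: nearW => n; rewrite /series/= big1// => i _.
  by rewrite /rl_kernel /pospow (negbTE t0) mul0r mulr0.
rewrite (_ : series _ = (fun n => t `^ (b - 1) *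
    series (fun n => (- (t `^ alpha)) ^+ n / Gamma (alpha * n%:R + b)) n)).
  by apply: cvgMl_tmp; exact: cvg_mittag_leffler.
apply/funext => n; rewrite /series/= mulr_sumr.
by apply: eq_bigr => i _; rewrite rl_kernelE// [in RHS]exprNn mulrCA -mulrA.
Qed.

Lemma is_cvg_rl_kernel_series (b t : R) : 0 < b ->
  cvgn (series (fun n => rl_kernel (alpha * n%:R + b) t)).
Proof.
move=> b0; have [t0|t0] := ltP 0 t; last first.
  apply/cvg_ex; exists 0.
  apply: cvg_near_cst; apply: nearW => n; rewrite /series/= big1// => i _.
  by rewrite /rl_kernel /pospow ltNge t0 mul0r.
rewrite (_ : series _ = (fun n => t `^ (b - 1) *
    series (fun n => (t `^ alpha) ^+ n / Gamma (alpha * n%:R + b)) n)).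
  by apply: is_cvgMl_tmp; apply/cvg_ex; eexists; exact: cvg_mittag_leffler.
apply/funext => n; rewrite /series/= mulr_sumr.
by apply: eq_bigr => i _; rewrite rl_kernelE.
Qed.

Lemma measurable_ml_kernel (b : R) : 0 < b -> measurable_fun setT (ml_kernel b).
Proof.
move=> b0; apply: (@measurable_fun_cvg _ _ _ _ (fun n t =>
  series (fun n => (- 1) ^+ n * rl_kernel (alpha * n%:R + b) t) n)).
  move=> n; rewrite /series/=; apply: measurable_sum => i.
  by apply: measurable_funM => //; exact: measurable_rl_kernel.
by move=> t _; exact: cvg_ml_kernel_series.
Qed.

(** Dropping the first term of the series changes the sign of the remaining ones. *)
Lemma ml_kernel_shift (b t : R) : 0 < b ->
  ml_kernel (alpha + b) t = rl_kernel b t - ml_kernel b t.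
Proof.
move=> b0; have ab0 : 0 < alpha + b by rewrite addr_gt0.
apply: (cvg_unique _ (cvg_ml_kernel_series (t := t) ab0)) => //.
pose v n := (- 1) ^+ n * rl_kernel (alpha * n%:R + b) t.
have h : series v (n + 1)%N @[n --> \oo] --> ml_kernel b t.
  by rewrite (cvg_shiftn 1 (series v)); exact: cvg_ml_kernel_series.
rewrite (_ : series _ = (fun n => rl_kernel b t -
    series v (n + 1)%N)).
  by apply: cvgB => //; exact: cvg_cst.
apply/funext => n /=.
rewrite addn1 /series/= [in RHS]big_nat_recl//= {1}/v mulr0 add0r expr0 mul1r.
rewrite opprD addrA subrr add0r.
rewrite -sumrN; apply: eq_bigr => i _.
rewrite /v exprS mulN1r mulNr opprK; congr (_ * rl_kernel _ _).
by rewrite -natr1; ring.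
Qed.

(** The semigroup law term by term; the series of absolute values has the integral
of the same series with positive signs, which is finite. *)
Lemma convol_ml_kernel (a b t : R) : 0 < a -> 0 < b ->
  convol (rl_kernel a) (ml_kernel b) t = (ml_kernel (a + b) t)%:E.
Proof.
move=> a0 b0; have ab0 : 0 < a + b by rewrite addr_gt0.
pose v n s := rl_kernel a (t - s) * rl_kernel (alpha * n%:R + b) s.
pose u n s := (- 1) ^+ n * v n s.
have v0 n s : 0 <= v n s.
  by rewrite mulr_ge0// rl_kernel_ge0// ml_argument_gt0.
have mv n : measurable_fun setT (v n).
  by apply: measurable_convol1; exact: measurable_rl_kernel.
have iv n : (\int[mu]_s (v n s)%:E = (rl_kernel (alpha * n%:R + (a + b)) t)%:E)%E.
  have := convol_rl_kernel t a0 (ml_argument_gt0 n b0).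
  by rewrite /convol addrCA.
have nu n s : `|u n s| = v n s by rewrite /u normrM normrX normrN1 expr1n mul1r ger0_norm.
have mu_ n : measurable_fun setT (u n) by exact: measurable_funM.
have iu n : (\int[mu]_s (u n s)%:E =
    ((- 1) ^+ n * rl_kernel (alpha * n%:R + (a + b)) t)%:E)%E.
  rewrite EFinM -iv -integralZl//.
  apply/integrableP; split; first by apply/measurable_EFinP; exact: mv.
  rewrite (_ : (fun x => _) = (fun s => (v n s)%:E)) ?iv ?ltry//.
  by apply/funext => s /=; rewrite ger0_norm.
apply: (cvg_unique _ (integral_dominated_series (u := u)
  (U := fun s => rl_kernel a (t - s) * ml_kernel b s) _ _ _ _)) => //.
- move=> s; rewrite (_ : series _ = (fun n => rl_kernel a (t - s) *
      series (fun n => (- 1) ^+ n * rl_kernel (alpha * n%:R + b) s) n)).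
    by apply: cvgMl_tmp; exact: cvg_ml_kernel_series.
  apply/funext => n; rewrite /series/= mulr_sumr.
  by apply: eq_bigr => i _; rewrite /u /v mulrCA.
- move=> s.
  rewrite (_ : [normed series _] = (fun n => rl_kernel a (t - s) *
      series (fun n => rl_kernel (alpha * n%:R + b) s) n)).
    by apply: is_cvgMl_tmp; exact: is_cvg_rl_kernel_series.
  apply/funext => n; rewrite /series/= mulr_sumr.
  by apply: eq_bigr => i _; rewrite nu.
- under eq_eseriesr do under eq_integral do rewrite nu.
  under eq_eseriesr do rewrite iv.
  under eq_fun do rewrite sumEFin.
  by rewrite EFin_lim ?ltry//; exact: is_cvg_rl_kernel_series.
rewrite (_ : (fun n => _) = (fun n =>
    (series (fun n => (- 1) ^+ n * rl_kernel (alpha * n%:R + (a + b)) t) n)%:E)).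
  by apply: cvg_EFin; [exact: nearW|exact: cvg_ml_kernel_series].
apply/funext => n; rewrite /series/= -sumEFin.
by apply: eq_bigr => i _; exact: iu.
Qed.

End mittag_leffler.

(** * Positivity of the Mittag-Leffler density *)
Section positivity.
Context {R : realType}.
Local Notation mu := (@lebesgue_measure R).
Variable alpha : R.
Hypothesis alpha0 : 0 < alpha.
Hypothesis alpha1 : alpha < 1.

Lemma ge0_powR_antitone (p x y : R) : p <= 0 -> 0 < x -> x <= y -> y `^ p <= x `^ p.
Proof.
move=> p0 x0 xy; rewrite -[p]opprK !(powRN _ (- p)).
rewrite lef_pV2 ?posrE ?powR_gt0 ?(lt_le_trans x0 xy)//.
by rewrite ge0_ler_powR ?nnegrE ?oppr_ge0// ltW// (lt_le_trans x0 xy).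
Qed.

Lemma Gamma1 : Gamma 1 = 1 :> R.
Proof. by apply: EFin_inj; rewrite EFin_Gamma// eGamma1. Qed.

Lemma continuous_ml_kernel (b t : R) : 0 < b -> 0 < t ->
  {for t, continuous (ml_kernel alpha b)}.
Proof.
move=> b0 t0.
have h : {for t, continuous (fun t => t `^ (b - 1) *
    mittag_leffler alpha b (- (t `^ alpha)))}.
  apply: continuousM; first exact: continuous_powR_gt0.
  apply: (@continuous_comp _ _ _ (fun t : R => - (t `^ alpha))).
    by apply: continuousN; exact: continuous_powR_gt0.
  exact: continuous_mittag_leffler.
have e : ml_kernel alpha b t = t `^ (b - 1) * mittag_leffler alpha b (- (t `^ alpha)).
  by rewrite /ml_kernel t0.
suff : ml_kernel alpha b s @[s --> t] -->
    t `^ (b - 1) * mittag_leffler alpha b (- (t `^ alpha)).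
  by rewrite -e.
apply: cvg_trans h; apply: near_eq_cvg; near=> s.
by rewrite /ml_kernel ifT//; near: s; exact: lt_nbhsr.
Unshelve. all: by end_near. Qed.

(** Near 0 the Mittag-Leffler function is close to its value 1 / Gamma(alpha). *)
Lemma ml_kernel_gt0_near0 : exists2 e : R, 0 < e &
  forall t, 0 < t -> t < e -> 0 < ml_kernel alpha alpha t.
Proof.
have c0 := @continuous_mittag_leffler R alpha alpha0 alpha alpha0 0.
have : \forall z \near (0 : R), 0 < mittag_leffler alpha alpha z.
  apply: (cvgr_gt _ c0).
  by rewrite mittag_leffler0// invr_gt0 Gamma_gt0.
move=> /nbhs_ballP[d /= d0 hd]; exists (d `^ alpha^-1); first by rewrite powR_gt0.
move=> t t0 td; rewrite /ml_kernel t0 mulr_gt0 ?powR_gt0//; apply: hd.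
rewrite /ball/= sub0r opprK ger0_norm ?powR_ge0//.
have -> : d = (d `^ alpha^-1) `^ alpha.
  by rewrite -powRrM mulVf ?gt_eqF// powRr1// ltW.
by rewrite gt0_ltr_powR// nnegrE ?powR_ge0// ltW.
Qed.

Lemma convol_ml_resolvent (t : R) :
  convol (rl_kernel alpha) (ml_kernel alpha alpha) t =
  (rl_kernel alpha t - ml_kernel alpha alpha t)%:E.
Proof. by have -> := convol_ml_kernel alpha0 t alpha0 alpha0; rewrite ml_kernel_shift. Qed.

(** Since alpha - 1 < 0, this is the inequality (u - s) t >= u (t - s). *)
Lemma rl_kernel_logconvex (s t u : R) : 0 < s -> s < t -> t <= u ->
  rl_kernel alpha (u - s) * rl_kernel alpha t <=
  rl_kernel alpha u * rl_kernel alpha (t - s).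
Proof.
move=> s0 st tu; have t0 := lt_trans s0 st; have u0 := lt_le_trans t0 tu.
have us0 : 0 < u - s by lra. have ts0 : 0 < t - s by lra.
have g0 := Gamma_gt0 alpha0.
rewrite /rl_kernel /pospow us0 t0 u0 ts0 mulrACA [leRHS]mulrACA.
rewrite ler_wpM2r ?mulr_ge0 ?invr_ge0 ?(ltW g0)//.
rewrite -!powRM ?(ltW us0) ?(ltW t0) ?(ltW u0) ?(ltW ts0)//; apply: ge0_powR_antitone.
- by rewrite subr_le0 ltW.
- exact: mulr_gt0.
- by nra.
Qed.

Lemma rl_kernel_gt0 (b x : R) : 0 < b -> 0 < x -> 0 < rl_kernel b x.
Proof. by move=> b0 x0; rewrite /rl_kernel /pospow x0 divr_gt0 ?Gamma_gt0 ?powR_gt0. Qed.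

Lemma rl_kernel_le0 (b x : R) : x <= 0 -> rl_kernel b x = 0.
Proof. by move=> x0; rewrite /rl_kernel /pospow ltNge x0 mul0r. Qed.

Lemma ml_kernel_le0 (b x : R) : x <= 0 -> ml_kernel alpha b x = 0.
Proof. by move=> x0; rewrite /ml_kernel ltNge x0. Qed.

Lemma rl_kernel1 (x : R) : 0 < x -> rl_kernel 1 x = 1.
Proof. by move=> x0; rewrite /rl_kernel /pospow Gamma1 subrr powRr0 x0 divr1. Qed.

Lemma rl_kernel_small (u : R) : 0 < u ->
  exists d : R, [/\ 0 < d, d <= u & rl_kernel (alpha + 1) (2 * d) < 2^-1].
Proof.
move=> u0.
have G0 : 0 < Gamma (alpha + 1) by apply: Gamma_gt0; rewrite addr_gt0.
rewrite /rl_kernel /pospow; move: (Gamma _) G0 => G G0.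
have r0 : 0 < (G / 4) `^ alpha^-1 / 2 by rewrite divr_gt0// powR_gt0// divr_gt0.
exists (Num.min u ((G / 4) `^ alpha^-1 / 2)).
have d0 : 0 < Num.min u ((G / 4) `^ alpha^-1 / 2) by rewrite lt_min u0.
split; rewrite ?ge_min ?lexx// mulr_gt0// addrK ltr_pdivrMr//.
apply: (@le_lt_trans _ _ (G / 4)); last by lra.
rewrite [leRHS](_ : _ = ((G / 4) `^ alpha^-1) `^ alpha); last first.
  by rewrite -powRrM mulVf ?gt_eqF// powRr1// divr_ge0// ltW.
rewrite ge0_ler_powR ?nnegrE ?powR_ge0 ?(ltW alpha0)// ?mulr_ge0 ?(ltW d0)//.
by rewrite mulrC -ler_pdivlMr// ge_min lexx orbT.
Qed.

Lemma rl_kernel_ratio (x u : R) : 0 < u -> u / 2 <= x -> x <= u ->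
  2^-1 <= rl_kernel alpha u / rl_kernel alpha x.
Proof.
move=> u0 ux xu; have x0 : 0 < x by lra.
have -> : rl_kernel alpha u / rl_kernel alpha x = (x / u) `^ (1 - alpha).
  rewrite /rl_kernel /pospow u0 x0 powRM ?invr_ge0 ?(ltW x0) ?(ltW u0)//.
  rewrite -[u^-1]powR_inv1 ?(ltW u0)// -powRrM mulN1r opprB.
  rewrite -[X in x `^ X]opprB powRN.
  have := powR_gt0 (1 - alpha) x0; have := Gamma_gt0 alpha0.
  move: (Gamma _) (_ `^ _) (_ `^ _) => y1 y2 y3 y10 y20.
  by field; rewrite !gt_eqF.
apply: (@le_trans _ _ (2^-1 `^ (1 - alpha))).
  rewrite -[leLHS](powRr1 (a := 2^-1))//.
  by apply: ger_powR; [lra|rewrite gerBl ltW].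
rewrite ge0_ler_powR ?nnegrE ?subr_ge0 ?divr_ge0 ?(ltW alpha1) ?(ltW x0) ?(ltW u0)//.
by rewrite ler_pdivlMr// mulrC.
Qed.

(** Evaluate the resolvent equation k * g = k - g at x and at u > x. By
log-convexity, over s < x the convolution at u is at most k(u) / k(x) times the
one at x; over the rest g is at most g(x). The cut at a < x instead of x only
enlarges the last term. *)
Lemma ml_resolvent_step (a x u : R) : 0 < x -> x < u -> a < x ->
  (forall s : R, 0 < s -> s < u -> 0 < ml_kernel alpha alpha s) ->
  (forall s, x <= s -> s < u -> ml_kernel alpha alpha s <= ml_kernel alpha alpha x) ->
  rl_kernel alpha u - ml_kernel alpha alpha u <=
    rl_kernel alpha u / rl_kernel alpha x * (rl_kernel alpha x - ml_kernel alpha alpha x) +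
    ml_kernel alpha alpha x * rl_kernel (alpha + 1) (u - a).
Proof.
set g := ml_kernel alpha alpha; set k := rl_kernel alpha.
move=> x0 xu ax gpos gmax.
have gx0 : 0 <= g x by rewrite ltW// gpos.
have k0 (s : R) : 0 <= k s by exact: rl_kernel_ge0.
have kx0 : 0 < k x by exact: rl_kernel_gt0.
have kk0 : 0 <= k u / k x by rewrite divr_ge0.
have kg0 (s y : R) : y <= u -> 0 <= k (y - s) * g s.
  move=> yu; have [s0|s0] := ltP 0 s; last by rewrite /g ml_kernel_le0// mulr0.
  have [sy|sy] := ltP s y.
    exact: mulr_ge0 (k0 _) (ltW (gpos _ s0 (lt_le_trans sy yu))).
  by rewrite /k rl_kernel_le0 ?mul0r// subr_le0.
have xu' := ltW xu.
have kf0 (s : R) : 0 <= k (u - s) * rl_kernel 1 (s - a).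
  exact: mulr_ge0 (k0 _) (rl_kernel_ge0 _ ltr01).
(* pointwise form of the estimate, to be integrated over s *)
have pw (s : R) : k (u - s) * g s <=
    k u / k x * (k (x - s) * g s) + g x * (k (u - s) * rl_kernel 1 (s - a)).
  have h1 := mulr_ge0 gx0 (kf0 s).
  have h2 := mulr_ge0 kk0 (kg0 s x xu').
  have [s0|s0] := ltP 0 s; last first.
    by apply: le_trans (addr_ge0 h2 h1); rewrite /g ml_kernel_le0// mulr0.
  have [sx|xs] := ltP s x.
    rewrite -[leLHS]addr0; apply: lerD => //; rewrite mulrA; apply: ler_wpM2r.
      by apply/ltW/gpos => //; exact: lt_trans xu.
    by rewrite mulrAC ler_pdivlMr//; exact: rl_kernel_logconvex s0 sx xu'.
  have [su|us] := ltP s u; last first.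
    by apply: le_trans (addr_ge0 h2 h1); rewrite /k rl_kernel_le0 ?subr_le0// mul0r.
  rewrite -[leLHS]add0r; apply: lerD => //.
  rewrite rl_kernel1 ?subr_gt0 ?(lt_le_trans ax)// mulr1 mulrC.
  by apply: ler_wpM2r => //; exact: gmax.
have mk (y : R) : measurable_fun setT (fun s : R => k (y - s) * g s).
  by apply: measurable_convol1; [exact: measurable_rl_kernel|exact: measurable_ml_kernel].
have m2 : measurable_fun setT (fun s : R => k (u - s) * rl_kernel 1 (s - a)).
  apply: measurable_funM.
    apply: (measurableT_comp (measurable_rl_kernel alpha)); exact: measurable_funB.
  apply: (measurableT_comp (measurable_rl_kernel 1)); exact: measurable_funB.
pose F (s : R) := k u / k x * (k (x - s) * g s).
pose H (s : R) := g x * (k (u - s) * rl_kernel 1 (s - a)).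
have mF : measurable_fun setT F by exact: measurable_funM.
have mH : measurable_fun setT H by exact: measurable_funM.
have F0 s : 0 <= F s := mulr_ge0 kk0 (kg0 _ _ xu').
have H0 s : 0 <= H s := mulr_ge0 gx0 (kf0 s).
have iF : (\int[mu]_s (F s)%:E = (k u / k x)%:E * convol k g x)%E.
  by apply: ge0_integralZE => // s; exact: kg0.
have iH : (\int[mu]_s (H s)%:E = (g x)%:E * (rl_kernel (alpha + 1) (u - a))%:E)%E.
  rewrite -(convol_rl_kernel_shift u a alpha0 ltr01); exact: ge0_integralZE.
have : (convol k g u <= \int[mu]_s (F s + H s)%:E)%E.
  by apply: ge0_le_integralE => //; [exact: measurable_funD|move=> s; exact: kg0].
rewrite ge0_integralDE// iF iH !convol_ml_resolvent -!EFinM -EFinD lee_fin.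
exact.
Qed.

(** If g(u) <= 0, take for x a maximum point of g on [u - d, u] in
[ml_resolvent_step]: g(u) >= g(x) (k(u) / k(x) - k_(alpha+1)(2 d)), where the
first term is at least 1 / 2 and the second is less than 1 / 2 for d small. *)
Lemma ml_kernel_no_first_zero (u : R) : 0 < u ->
  (forall s : R, 0 < s -> s < u -> 0 < ml_kernel alpha alpha s) ->
  0 < ml_kernel alpha alpha u.
Proof.
move=> u0 gpos; rewrite ltNge; apply/negP => gu.
have [|d [d0 du d_small]] := @rl_kernel_small (u / 2); first by rewrite divr_gt0.
have [x xI xmax] : exists2 x, x \in `[u - d, u] &
    forall s, s \in `[u - d, u] -> ml_kernel alpha alpha s <= ml_kernel alpha alpha x.
  apply: EVT_max; first by rewrite gerBl ltW.
  apply: continuous_in_subspaceT => s; rewrite inE/= in_itv/= => /andP[ds _].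
  by apply: continuous_ml_kernel => //; lra.
move: xI; rewrite in_itv/= => /andP[dx xu].
have gx0 : 0 < ml_kernel alpha alpha x.
  apply: (@lt_le_trans _ _ (ml_kernel alpha alpha (u - d))).
    by apply: gpos; lra.
  by apply: xmax; rewrite in_itv/= lexx/= gerBl ltW.
have {}xu : x < u.
  by rewrite lt_neqAle xu andbT; apply/eqP => xu'; move: gx0; rewrite xu' ltNge gu.
have x0 : 0 < x by lra.
have : rl_kernel alpha u - ml_kernel alpha alpha u <=
    rl_kernel alpha u / rl_kernel alpha x * (rl_kernel alpha x - ml_kernel alpha alpha x) +
    ml_kernel alpha alpha x * rl_kernel (alpha + 1) (2 * d).
  (* the cut at u - 2 d lies below u - d <= x, as the strict a < x requires *)
  have -> : 2 * d = u - (u - 2 * d) by ring.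
  apply: ml_resolvent_step => //.
    by lra.
  by move=> s xs su; apply: xmax; rewrite in_itv/= (ltW su) (le_trans dx).
have := @rl_kernel_ratio x u u0; have := rl_kernel_gt0 alpha0 x0.
move: (rl_kernel _ _) (rl_kernel alpha x) (rl_kernel alpha u)
  (ml_kernel _ _ _) (ml_kernel _ _ _) d_small gx0 gu.
move=> f kx ku gx gu f2 gx0 gu0 kx0 /(_ _ (ltW xu)).
have ux2 : u / 2 <= x by lra.
move=> /(_ ux2); rewrite mulrBr divfK ?gt_eqF//.
move: (ku / kx) => r r2 h; nra.
Qed.

Lemma ml_kernel_gt0 (t : R) : 0 < t -> 0 < ml_kernel alpha alpha t.
Proof.
move=> tpos; rewrite ltNge; apply/negP => gt.
have [e e0 he] := ml_kernel_gt0_near0.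
pose A := [set x : R | 0 < x /\ ml_kernel alpha alpha x <= 0].
have infA : has_inf A.
  by split; [exists t|exists 0 => x [/ltW]].
have et0 : e <= inf A.
  apply: lb_le_inf; first by exists t.
  by move=> x [x0 gx]; rewrite leNgt; apply/negP => /(he _ x0); rewrite ltNge gx.
have t00 : 0 < inf A := lt_le_trans e0 et0.
have gpos s : 0 < s -> s < inf A -> 0 < ml_kernel alpha alpha s.
  move=> s0 st0; rewrite ltNge; apply/negP => gs.
  have : inf A <= s by apply: ge_inf => //; exact: infA.2.
  by rewrite leNgt st0.
have gt0 := ml_kernel_no_first_zero t00 gpos.
have : \forall s \near inf A, 0 < ml_kernel alpha alpha s.
  exact: (cvgr_gt _ (continuous_ml_kernel alpha0 t00)).
move=> /nbhs_ballP[d /= d0 hd].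
have [a [a0 ga] atd] := inf_adherent d0 infA.
have t0a : inf A <= a by apply: ge_inf => //; exact: infA.2.
have : 0 < ml_kernel alpha alpha a.
  apply: hd; rewrite /ball/= distrC ger0_norm ?subr_ge0//.
  by rewrite ltrBlDl.
by rewrite ltNge ga.
Qed.

End positivity.

(** * Decay of the relaxation function *)
Section relaxation.
Context {R : realType}.
Local Notation mu := (@lebesgue_measure R).
Variable alpha : R.
Hypothesis alpha0 : 0 < alpha.
Hypothesis alpha1 : alpha < 1.

Local Notation g := (ml_kernel alpha alpha).
Local Notation relax := (ml_kernel alpha 1).

Let p0 : 0 < 1 - alpha. Proof. by rewrite subr_gt0. Qed.
Let q0 : 0 < 2 - alpha. Proof. by rewrite subr_gt0 (lt_trans alpha1) ?ltr1n. Qed.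

Lemma ml_density_ge0 (t : R) : 0 <= g t.
Proof.
have [t0|t0] := ltP 0 t; first exact/ltW/ml_kernel_gt0.
by rewrite ml_kernel_le0.
Qed.

Lemma le_rl_kernel (b x y : R) : 1 <= b -> x <= y -> rl_kernel b x <= rl_kernel b y.
Proof.
move=> b1 xy; have b0 : 0 < b := lt_le_trans ltr01 b1.
have [x0|x0] := ltP 0 x; last by rewrite rl_kernel_le0// rl_kernel_ge0.
have y0 := lt_le_trans x0 xy.
rewrite /rl_kernel /pospow x0 y0 ler_wpM2r ?invr_ge0 ?(ltW (Gamma_gt0 b0))//.
by rewrite ge0_ler_powR ?nnegrE ?subr_ge0 ?(ltW x0) ?(ltW y0).
Qed.

Lemma ge_rl_kernel (b x y : R) : 0 < b -> b <= 1 -> 0 < x -> x <= y ->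
  rl_kernel b y <= rl_kernel b x.
Proof.
move=> b0 b1 x0 xy; have y0 := lt_le_trans x0 xy.
rewrite /rl_kernel /pospow x0 y0 ler_wpM2r ?invr_ge0 ?(ltW (Gamma_gt0 b0))//.
by apply: ge0_powR_antitone => //; rewrite subr_le0.
Qed.

Lemma measurable_ml_convol (b c t : R) : 0 < c ->
  measurable_fun setT (fun s : R => rl_kernel b (t - s) * ml_kernel alpha c s).
Proof.
move=> c0; apply: measurable_convol1; first exact: measurable_rl_kernel.
exact: measurable_ml_kernel.
Qed.

(** h_b is the convolution of k_(b - alpha) with g. *)
Lemma ml_kernel_ge0 (b t : R) : alpha < b -> 0 <= ml_kernel alpha b t.
Proof.
move=> ab; rewrite -lee_fin -{1}(subrK alpha b).
have b0 : 0 < b - alpha by rewrite subr_gt0.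
have <- := convol_ml_kernel alpha0 t b0 alpha0.
by apply: integral_ge0 => s _; rewrite lee_fin mulr_ge0 ?rl_kernel_ge0 ?ml_density_ge0.
Qed.

Lemma convol_ml_density (t : R) : 0 < t -> convol (rl_kernel 1) g t = (1 - relax t)%:E.
Proof.
move=> t0; have -> := convol_ml_kernel alpha0 t ltr01 alpha0.
by rewrite (addrC 1) ml_kernel_shift// rl_kernel1.
Qed.

Lemma relax_le1 (t : R) : 0 < t -> relax t <= 1.
Proof.
move=> t0; rewrite -subr_ge0 -lee_fin -convol_ml_density//.
by apply: integral_ge0 => s _; rewrite lee_fin mulr_ge0 ?rl_kernel_ge0 ?ml_density_ge0.
Qed.

Lemma relax_antitone (s t : R) : 0 < s -> s <= t -> relax t <= relax s.
Proof.
move=> s0 st; have t0 := lt_le_trans s0 st.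
have : (convol (rl_kernel 1) g s <= convol (rl_kernel 1) g t)%E.
  apply: ge0_le_integralE; do ?exact: measurable_ml_convol.
    by move=> r; rewrite mulr_ge0 ?rl_kernel_ge0 ?ml_density_ge0.
  move=> r; apply: ler_wpM2r; first exact: ml_density_ge0.
  by apply: le_rl_kernel => //; rewrite lerD2r.
by rewrite (convol_ml_density s0) (convol_ml_density t0) lee_fin lerD2l lerN2.
Qed.

(** S is nonincreasing, so S(t) times the integral of k_alpha over (0, t) is at most
k_alpha * S = 1 - S. *)
Lemma relax_le_powR (t : R) : 0 < t -> relax t <= Gamma (alpha + 1) * t `^ (- alpha).
Proof.
move=> t0; have a10 : 0 < alpha + 1 by rewrite addr_gt0.
suff : relax t * rl_kernel (alpha + 1) t <= 1.
  rewrite /rl_kernel /pospow t0 addrK mulrA ler_pdivrMr ?Gamma_gt0// mul1r powRN.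
  by rewrite ler_pdivlMr// powR_gt0.
have S0 r : 0 <= relax r by exact: ml_kernel_ge0.
apply: (@le_trans _ _ (1 - relax t)); last by rewrite gerBl.
rewrite -lee_fin EFinM -(convol_rl_kernel t alpha0 ltr01) -ge0_integralZE//.
- have -> : (1 - relax t)%:E = convol (rl_kernel alpha) relax t.
    have -> := convol_ml_kernel alpha0 t alpha0 ltr01.
    by rewrite ml_kernel_shift// rl_kernel1.
  apply: ge0_le_integralE; do ?exact: measurable_ml_convol.
  + apply: measurable_funM => //; apply: measurable_convol1; exact: measurable_rl_kernel.
  + by move=> s; rewrite mulr_ge0// mulr_ge0 ?rl_kernel_ge0.
  + move=> s; rewrite mulrCA; have [st|ts] := ltP s t; last first.
      by rewrite rl_kernel_le0 ?subr_le0// !mul0r.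
    apply: ler_wpM2l; first exact: rl_kernel_ge0.
    have [s0|s0] := ltP 0 s; last by rewrite rl_kernel_le0// mulr0.
    by rewrite rl_kernel1// mulr1; apply: relax_antitone => //; exact: ltW.
- apply: measurable_convol1; exact: measurable_rl_kernel.
- by move=> s; rewrite mulr_ge0 ?rl_kernel_ge0.
Qed.

(** In S = k_(1-alpha) * g the kernel is nonincreasing, so k_(1-alpha)(t - s) is at
least k_(1-alpha)(t). *)
Lemma relax_ge (t : R) : 0 < t -> rl_kernel (1 - alpha) t * (1 - relax t) <= relax t.
Proof.
move=> t0; rewrite -lee_fin EFinM -(convol_ml_density t0) -ge0_integralZE ?rl_kernel_ge0//.
- rewrite -[in leRHS](subrK alpha 1); have <- := convol_ml_kernel alpha0 t p0 alpha0.
  apply: ge0_le_integralE; do ?exact: measurable_ml_convol.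
  + apply: measurable_funM => //; exact: measurable_ml_convol.
  + by move=> s; rewrite mulr_ge0 ?rl_kernel_ge0// mulr_ge0 ?rl_kernel_ge0 ?ml_density_ge0.
  + move=> s; rewrite mulrA.
    have [s0|s0] := ltP 0 s; last by rewrite ml_kernel_le0// !mulr0.
    apply: ler_wpM2r; first exact: ml_density_ge0.
    have [st|ts] := ltP s t; last first.
      by rewrite ![rl_kernel _ (t - s)]rl_kernel_le0 ?subr_le0// mulr0.
    rewrite rl_kernel1 ?subr_gt0// mulr1; apply: ge_rl_kernel => //.
    * by rewrite gerBl ltW.
    * by rewrite subr_gt0.
    * by rewrite gerBl ltW.
- exact: measurable_ml_convol.
- by move=> s; rewrite mulr_ge0 ?rl_kernel_ge0 ?ml_density_ge0.
Qed.

Lemma ml_kernel2_convol (t : R) :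
  convol (rl_kernel (2 - alpha)) g t = (ml_kernel alpha 2 t)%:E.
Proof. by have -> := convol_ml_kernel alpha0 t q0 alpha0; rewrite subrK. Qed.

(** In h_2 = k_(2-alpha) * g the kernel is nondecreasing; here it is bounded by its
value at t, and in [ml_kernel2_ge] from below on s < v by its value at t - v. *)
Lemma ml_kernel2_le (t : R) : 0 < t -> ml_kernel alpha 2 t <= rl_kernel (2 - alpha) t.
Proof.
move=> t0; apply: (@le_trans _ _ (rl_kernel (2 - alpha) t * (1 - relax t))); last first.
  by rewrite ler_piMr ?rl_kernel_ge0// gerBl ml_kernel_ge0.
rewrite -lee_fin EFinM -(convol_ml_density t0) -ge0_integralZE ?rl_kernel_ge0//.
- rewrite -ml_kernel2_convol; apply: ge0_le_integralE; do ?exact: measurable_ml_convol.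
  + apply: measurable_funM => //; exact: measurable_ml_convol.
  + by move=> s; rewrite mulr_ge0 ?rl_kernel_ge0 ?ml_density_ge0.
  + move=> s; rewrite mulrA.
    have [s0|s0] := ltP 0 s; last by rewrite ml_kernel_le0// !mulr0.
    apply: ler_wpM2r; first exact: ml_density_ge0.
    have [st|ts] := ltP s t; last first.
      by rewrite ![rl_kernel _ (t - s)]rl_kernel_le0 ?subr_le0// mulr0.
    rewrite rl_kernel1 ?subr_gt0// mulr1; apply: le_rl_kernel; last by rewrite gerBl ltW.
    by rewrite lerBrDr -lerBrDl; have := alpha1; lra.
- exact: measurable_ml_convol.
- by move=> s; rewrite mulr_ge0 ?rl_kernel_ge0 ?ml_density_ge0.
Qed.

Lemma ml_kernel2_ge (t v : R) : 0 < v ->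
  rl_kernel (2 - alpha) (t - v) * (1 - relax v) <= ml_kernel alpha 2 t.
Proof.
move=> v0; rewrite -lee_fin EFinM -(convol_ml_density v0) -ge0_integralZE ?rl_kernel_ge0//.
- rewrite -ml_kernel2_convol; apply: ge0_le_integralE; do ?exact: measurable_ml_convol.
  + apply: measurable_funM => //; exact: measurable_ml_convol.
  + by move=> s; rewrite mulr_ge0 ?rl_kernel_ge0// mulr_ge0 ?rl_kernel_ge0 ?ml_density_ge0.
  + move=> s; rewrite mulrA; apply: ler_wpM2r; first exact: ml_density_ge0.
    have [sv|vs] := ltP s v; last first.
      by rewrite [rl_kernel 1 _]rl_kernel_le0 ?subr_le0// mulr0 rl_kernel_ge0.
    rewrite rl_kernel1 ?subr_gt0// mulr1.
    apply: le_rl_kernel; last by rewrite lerD2l lerN2 ltW.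
    by have := alpha1; lra.
- exact: measurable_ml_convol.
- by move=> s; rewrite mulr_ge0 ?rl_kernel_ge0 ?ml_density_ge0.
Qed.

(** h_2 is the primitive of S, and S is nonincreasing. *)
Lemma relax_le_ml_kernel2_diff (s t : R) : 0 < s -> s <= t ->
  relax t * (t - s) <= ml_kernel alpha 2 t - ml_kernel alpha 2 s.
Proof.
move=> s0 st; have t0 := lt_le_trans s0 st.
have S0 r : 0 <= relax r by exact: ml_kernel_ge0.
have h2 u : (ml_kernel alpha 2 u)%:E = convol (rl_kernel 1) relax u.
  by have -> := convol_ml_kernel alpha0 u ltr01 ltr01.
have f0 (r : R) : 0 <= rl_kernel 1 r := rl_kernel_ge0 r ltr01.
pose F (r : R) := rl_kernel 1 (s - r) * relax r.
pose H (r : R) := relax t * (rl_kernel 1 (t - r) * rl_kernel 1 (r - s)).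
have mP : measurable_fun setT (fun r : R => rl_kernel 1 (t - r) * rl_kernel 1 (r - s)).
  apply: measurable_funM; apply: (measurableT_comp (measurable_rl_kernel 1));
  exact: measurable_funB.
have P0 (r : R) : 0 <= rl_kernel 1 (t - r) * rl_kernel 1 (r - s) by exact: mulr_ge0.
have F0 r : 0 <= F r := mulr_ge0 (f0 _) (S0 _).
have H0 r : 0 <= H r := mulr_ge0 (S0 _) (P0 _).
have mF : measurable_fun setT F := measurable_ml_convol 1 s ltr01.
have mH : measurable_fun setT H by exact: measurable_funM.
have iH : (\int[mu]_r (H r)%:E = (relax t * rl_kernel 2 (t - s))%:E)%E.
  by rewrite EFinM -(convol_rl_kernel_shift t s ltr01 ltr01); exact: ge0_integralZE.
have FH : (\int[mu]_r (F r + H r)%:E <= convol (rl_kernel 1) relax t)%E.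
  apply: ge0_le_integralE => //; first exact: measurable_funD.
  - exact: measurable_ml_convol.
  - by move=> r; rewrite addr_ge0.
  - move=> r; rewrite /F /H; have [r0|r0] := ltP 0 r; last first.
      rewrite ml_kernel_le0// [rl_kernel 1 (r - s)]rl_kernel_le0 ?subr_le0.
        by rewrite !mulr0 addr0.
      exact: le_trans r0 (ltW s0).
    have [rs|sr] := ltP s r; last first.
      rewrite [rl_kernel 1 (r - s)]rl_kernel_le0 ?subr_le0// !mulr0 addr0.
      by apply: ler_wpM2r => //; apply: le_rl_kernel => //; rewrite lerD2r.
    rewrite [rl_kernel 1 (s - r)]rl_kernel_le0 ?subr_le0 ?(ltW rs)// mul0r add0r.
    rewrite (rl_kernel1 (x := r - s)) ?subr_gt0// mulr1 mulrC.
    have [rt|tr] := ltP r t.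
      by apply: ler_wpM2l; [exact: f0|exact: relax_antitone r0 (ltW rt)].
    have -> : rl_kernel 1 (t - r) = 0 by apply: rl_kernel_le0; rewrite subr_le0.
    by rewrite !mul0r.
move: FH; rewrite ge0_integralDE// iH -h2.
rewrite -/(convol (rl_kernel 1) relax s) -h2 -EFinD lee_fin.
have -> : rl_kernel 2 (t - s) = t - s.
  have [ts|ts] := ltP 0 (t - s).
    have G2 : Gamma 2 = 1 :> R by rewrite GammaD1// Gamma1 mulr1.
    by rewrite /rl_kernel /pospow ts G2 divr1 (_ : 2 - 1 = 1) ?powRr1 ?(ltW ts)//; ring.
  by rewrite rl_kernel_le0//; apply/eqP; rewrite eq_le ts subr_ge0 st.
by rewrite lerBrDl.
Qed.

End relaxation.

(** * The equivalent of the relaxation function *)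
Section relaxation_asymptotics.
Context {R : realType}.
Variable alpha : R.
Hypothesis alpha0 : 0 < alpha.
Hypothesis alpha1 : alpha < 1.

Local Notation relax := (ml_kernel alpha 1).

Let p0 : 0 < 1 - alpha. Proof. by rewrite subr_gt0. Qed.
Let q0 : 0 < 2 - alpha. Proof. by rewrite subr_gt0 (lt_trans alpha1) ?ltr1n. Qed.

Lemma relax_cvg0 : relax t @[t --> +oo] --> (0 : R).
Proof.
apply: (@squeeze_cvgr _ _ _ _ (cst 0) (fun t => Gamma (alpha + 1) * t `^ (- alpha))).
- near=> t; have t0 : 0 < t by near: t; exact: nbhs_pinfty_gt.
  by rewrite ml_kernel_ge0//= relax_le_powR.
- exact: cvg_cst.
- rewrite -[X in _ --> X](mulr0 (Gamma (alpha + 1))); apply: cvgMl_tmp.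
  exact: cvgr_powRN.
Unshelve. all: by end_near. Qed.

Lemma powR_chord (p l : R) : 0 < p -> p <= 1 -> 0 < l -> l < 1 ->
  1 - l `^ p <= p * l `^ (p - 1) * (1 - l).
Proof.
move=> pp p1 l0 l1.
have [||c cI] := @MVT R (fun x => x `^ p) (fun x => p * x `^ (p - 1)) l 1 l1.
- move=> x; rewrite in_itv/= => /andP[lx _]; apply: is_derive1_powR.
  exact: lt_trans lx.
- apply: continuous_in_subspaceT => x; rewrite inE/= in_itv/= => /andP[lx _].
  by apply: continuous_powR_gt0; exact: lt_le_trans lx.
rewrite powR1 => ->; move: cI; rewrite in_itv/= => /andP[lc c1].
apply: ler_wpM2r; first by rewrite subr_ge0 ltW.
apply: ler_wpM2l; first exact: ltW.
by apply: ge0_powR_antitone => //; [rewrite subr_le0|exact: ltW].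
Qed.

Lemma powR_half (t : R) : 0 < t -> t `^ 2^-1 = t * t `^ (- 2^-1).
Proof.
move=> t0; have h : 2^-1 = 1 + - 2^-1 :> R by field.
by rewrite [in LHS]h powRD ?(gt_eqF t0) ?implybT// powRr1// ltW.
Qed.

(** S(t) (t - l t) <= h_2(t) - h_2(l t) with the two-sided bounds on h_2. The cut
v = sqrt t in [ml_kernel2_ge] tends to +oo, so that 1 - S(v) tends to 1, and is
negligible against t. *)
Lemma relax_upper (l t : R) : 0 < l -> l < 1 -> 0 < t ->  0 < l - t `^ (- 2^-1) ->
  t `^ alpha * relax t <=
  (1 - (l - t `^ (- 2^-1)) `^ (1 - alpha) * (1 - relax (t `^ 2^-1))) /
    ((1 - l) * Gamma (2 - alpha)).
Proof.
move=> l0 l1 t0 lt0; have st0 : 0 < t `^ 2^-1 by rewrite powR_gt0.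
have G0 := Gamma_gt0 q0; have l10 : 0 < 1 - l by rewrite subr_gt0.
rewrite ler_pdivlMr ?mulr_gt0//.
have h1 := relax_le_ml_kernel2_diff alpha0 alpha1 (mulr_gt0 l0 t0)
  (ler_piMl (ltW t0) (ltW l1)).
have h2 := ml_kernel2_le alpha0 alpha1 t0.
have h3 := ml_kernel2_ge alpha0 alpha1 (l * t) st0.
have ta : t = t `^ alpha * t `^ (1 - alpha).
  rewrite -powRD ?(gt_eqF t0) ?implybT// addrC subrK powRr1//; exact: ltW.
have k1 : rl_kernel (2 - alpha) t = t `^ (1 - alpha) / Gamma (2 - alpha).
  by rewrite /rl_kernel /pospow t0; congr (_ `^ _ / _); ring.
have e : l * t - t `^ 2^-1 = t * (l - t `^ (- 2^-1)).
  by rewrite mulrBr -powR_half// mulrC.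
have k2 : rl_kernel (2 - alpha) (l * t - t `^ 2^-1) =
    t `^ (1 - alpha) * (l - t `^ (- 2^-1)) `^ (1 - alpha) / Gamma (2 - alpha).
  rewrite e /rl_kernel /pospow mulr_gt0// -powRM ?(ltW t0) ?(ltW lt0)//.
  by congr (_ `^ _ / _); ring.
have T0 : 0 < t `^ (1 - alpha) by rewrite powR_gt0.
have {}h1 : relax t * (1 - l) * (t `^ alpha * t `^ (1 - alpha)) <=
    ml_kernel alpha 2 t - ml_kernel alpha 2 (l * t).
  by rewrite -ta (_ : _ * t = relax t * (t - l * t))//; ring.
move: h2 h3 h1; rewrite k1 k2; move: G0 T0.
move: (Gamma _) (t `^ (1 - alpha)) (t `^ alpha) (ml_kernel alpha 2 _) (ml_kernel alpha 2 _).
move: (relax t) (relax _) ((l - _) `^ _) => x y B G T A m n G0 T0 h2 h3 h1.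
have TG : 0 < T / G by rewrite divr_gt0.
rewrite -(ler_pM2l TG).
have -> : T / G * (A * x * ((1 - l) * G)) = x * (1 - l) * (A * T).
  by field; rewrite gt_eqF.
apply: (le_trans h1).
have -> : T / G * (1 - B * (1 - y)) = T / G - T * B / G * (1 - y) by ring.
exact: lerB.
Qed.

(** The lower bound is [relax_ge]. In [relax_upper] the bound tends, as t grows, to
(1 - l^(1-alpha)) / ((1 - l) Gamma(2 - alpha)), which is at most
l^(-alpha) / Gamma(1 - alpha) because Gamma(2 - alpha) =
(1 - alpha) Gamma(1 - alpha); it remains to let l tend to 1. *)
Lemma relax_asymptotic :
  t `^ alpha * relax t @[t --> +oo] --> (Gamma (1 - alpha))^-1.
Proof.
have G10 := Gamma_gt0 p0; have G20 := Gamma_gt0 q0.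
pose L := (Gamma (1 - alpha))^-1.
have L0 : 0 < L by rewrite /L invr_gt0.
have GG : Gamma (2 - alpha) = (1 - alpha) / L.
  rewrite /L invrK -(GammaD1 p0) (_ : 2 - alpha = 1 + (1 - alpha))//; ring.
have half0 : (0 : R) < 2^-1 by [].
have cvg_half : t `^ (- 2^-1) @[t --> +oo] --> (0 : R) by exact: cvgr_powRN.
have cvg_sqrt : relax (t `^ 2^-1) @[t --> +oo] --> (0 : R).
  apply: (@squeeze_cvgr _ _ _ _ (cst 0)
    (fun t => Gamma (alpha + 1) * t `^ (- (2^-1 * alpha)))).
  - near=> t; have t0 : 0 < t by near: t; exact: nbhs_pinfty_gt.
    by rewrite ml_kernel_ge0//= -mulrN powRrM relax_le_powR// powR_gt0.
  - exact: cvg_cst.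
  - rewrite -[X in _ --> X](mulr0 (Gamma (alpha + 1))); apply: cvgMl_tmp.
    by apply: cvgr_powRN; rewrite mulr_gt0.
apply/cvgrPdist_le => e e0.
(* l is so close to 1 that L * l `^ (- alpha) = L + e / 2 *)
pose l := (1 + e / (2 * L)) `^ (- alpha^-1).
have b1 : 1 < 1 + e / (2 * L) by rewrite ltrDl divr_gt0// mulr_gt0.
have b0 := lt_trans ltr01 b1.
have l0 : 0 < l by rewrite powR_gt0.
have l1 : l < 1.
  rewrite /l powRN invf_lt1 ?powR_gt0//.
  rewrite [ltLHS](_ : _ = 1 `^ alpha^-1); last by rewrite powR1.
  by rewrite gt0_ltr_powR ?invr_gt0 ?nnegrE ?(ltW b0).
have lL : L * l `^ (- alpha) = L + e / 2.
  rewrite /l -powRrM mulrNN mulVf ?gt_eqF// powRr1 ?(ltW b0)//.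
  by field; rewrite gt_eqF.
have l10 : 0 < 1 - l by rewrite subr_gt0.
pose U t := (1 - (l - t `^ (- 2^-1)) `^ (1 - alpha) * (1 - relax (t `^ 2^-1))) /
    ((1 - l) * Gamma (2 - alpha)).
have cU : U t @[t --> +oo] -->
    (1 - l `^ (1 - alpha)) / ((1 - l) * Gamma (2 - alpha)).
  have c1 : l - t `^ (- 2^-1) @[t --> +oo] --> l - 0.
    by apply: cvgB => //; exact: cvg_cst.
  rewrite subr0 in c1.
  have c2 : (l - t `^ (- 2^-1)) `^ (1 - alpha) @[t --> +oo] --> l `^ (1 - alpha).
    apply: (@continuous_cvg _ _ _ _ _ _ (fun x : R => x `^ (1 - alpha))) => //.
    exact: continuous_powR_gt0.
  have c3 : 1 - relax (t `^ 2^-1) @[t --> +oo] --> (1 : R) - 0.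
    by apply: cvgB => //; exact: cvg_cst.
  apply: cvgMr_tmp; apply: cvgB; first exact: cvg_cst.
  have c4 : (l - t `^ (- 2^-1)) `^ (1 - alpha) * (1 - relax (t `^ 2^-1)) @[t --> +oo] -->
      l `^ (1 - alpha) * (1 - 0) by exact: cvgM.
  by rewrite subr0 mulr1 in c4.
have Ule : (1 - l `^ (1 - alpha)) / ((1 - l) * Gamma (2 - alpha)) < L + e.
  apply: (@le_lt_trans _ _ (L + e / 2)); last by rewrite ltrD2l gtr_pMr// invf_lt1// ltr1n.
  rewrite ler_pdivrMr ?mulr_gt0// -lL GG.
  apply: (le_trans (powR_chord p0 _ l0 l1)); first by rewrite gerBl ltW.
  rewrite le_eqVlt; apply/orP; left; apply/eqP.
  have -> : 1 - alpha - 1 = - alpha by ring.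
  by field; rewrite gt_eqF.
near=> t.
have t0 : 0 < t by near: t; exact: nbhs_pinfty_gt.
have lt0 : 0 < l - t `^ (- 2^-1).
  by rewrite subr_gt0; near: t; exact: (cvgr_lt _ cvg_half).
have up : t `^ alpha * relax t <= L + e.
  apply: le_trans (relax_upper l0 l1 t0 lt0) _; rewrite -/(U t).
  by near: t; exact: (cvgr_le _ cU).
have low : L - e <= t `^ alpha * relax t.
  have S1 : relax t <= e / L.
    by near: t; apply: (cvgr_le _ relax_cvg0); rewrite divr_gt0.
  apply: (@le_trans _ _ (L * (1 - relax t))).
    by rewrite mulrBr mulr1 lerD2l lerN2 mulrC -ler_pdivlMr.
  have := relax_ge alpha0 alpha1 t0; rewrite -(ler_pM2l (powR_gt0 alpha t0)).
  apply: le_trans.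
  rewrite mulrA /rl_kernel /pospow t0 (_ : 1 - alpha - 1 = - alpha); last by ring.
  by rewrite mulrA -powRD ?(gt_eqF t0) ?implybT// subrr powRr0 mul1r.
by rewrite ler_distlC low up.
Unshelve. all: by end_near. Qed.

End relaxation_asymptotics.

(** * The mass defect as an integral of K *)
Section representation.
Context {R : realType}.
Local Notation mu := (@lebesgue_measure R).
Variables alpha c : R.
Hypothesis alpha0 : 0 < alpha.
Hypothesis alpha1 : alpha < 1.
Hypothesis c0 : 0 < c.
Variable K : R -> R.
Hypothesis iK : mu.-integrable [set: R] (EFin \o K).
Hypothesis mK : measurable_fun [set: R] K.
Hypothesis K0 : forall x, 0 <= K x.
Hypothesis K_even : forall x, K x = K (- x).

Local Notation g := (ml_kernel alpha alpha).

(** The tail of the distribution with density g. *)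
Definition survival (u : R) : R := if 0 < u then ml_kernel alpha 1 u else 1.

Lemma survival_ge0 u : 0 <= survival u.
Proof. by rewrite /survival; case: ifP => // _; exact: ml_kernel_ge0. Qed.

Lemma survival_le1 u : survival u <= 1.
Proof. by rewrite /survival; case: ifP => // u0; exact: relax_le1. Qed.

Lemma measurable_survival : measurable_fun setT survival.
Proof.
apply: measurable_fun_ifT => //; first exact: measurable_fun_ltr.
exact: measurable_ml_kernel.
Qed.

Lemma convol_survival u : convol (rl_kernel 1) g u = (1 - survival u)%:E.
Proof.
rewrite /survival; case: ifPn => u0; first exact: convol_ml_density.
have -> := convol_ml_kernel alpha0 u ltr01 alpha0.
by rewrite ml_kernel_le0 ?subrr// leNgt.
Qed.

Lemma EFin_tail_integral x :
  (tail_integral K x)%:E = (\int[mu]_y (rl_kernel 1 (y - x) * K y)%:E)%E.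
Proof.
have ixK : mu.-integrable `[x, +oo[ (EFin \o K) by exact: integrableS iK.
rewrite /tail_integral /Rintegral fineK; last exact: integrable_fin_num.
rewrite -integral_itv_obnd_cbnd; last first.
  by apply/measurable_EFinP; exact: measurable_funTS.
rewrite integral_mkcond; apply: eq_integral => y _.
rewrite patchE mem_setE in_itv/= andbT; case: ltP => xy.
  by rewrite rl_kernel1 ?mul1r// subr_gt0.
by rewrite rl_kernel_le0 ?mul0r// subr_le0.
Qed.

Lemma rl_kernel1_scale u : rl_kernel 1 (c * u) = rl_kernel 1 u.
Proof.
have [u0|u0] := ltP 0 u; first by rewrite !rl_kernel1// mulr_gt0.
by rewrite !rl_kernel_le0// mulr_ge0_le0// ltW.
Qed.

(** The tail integral is the integral of K(y) over y > z + c r, that is, over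
r < (y - z) / c. Exchanging the integrals leaves the distribution function of g
at (y - z) / c. *)
Lemma integral_phi z :
  (\int[mu]_(r in `]0%R, +oo[) (g_ml alpha r * tail_integral K (z + c * r))%:E =
   \int[mu]_y (K y * (1 - survival ((y - z) / c)))%:E)%E.
Proof.
have aux (y r : R) : y - (z + c * r) = c * ((y - z) / c - r).
  by field; rewrite gt_eqF.
pose f (r y : R) := (g r * (rl_kernel 1 (y - (z + c * r)) * K y))%:E.
have g0 r : 0 <= g r by exact: ml_density_ge0.
have f0 r y : (0 <= f r y)%E.
  by rewrite lee_fin mulr_ge0// mulr_ge0// rl_kernel_ge0.
have mg : measurable_fun setT g by exact: measurable_ml_kernel.
have mf : measurable_fun setT (fun p : R * R => f p.1 p.2).
  apply/measurable_EFinP; apply: measurable_funM.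
    exact: measurableT_comp.
  apply: measurable_funM; last exact: measurableT_comp.
  apply: (measurableT_comp (measurable_rl_kernel 1)).
  apply: measurable_funB => //; apply: measurable_funD => //.
  exact: measurable_funM.
transitivity (\int[mu]_r \int[mu]_y f r y)%E.
  rewrite integral_mkcond; apply: eq_integral => r _.
  rewrite patchE mem_setE in_itv/= andbT /f; case: ifPn => r0; last first.
    rewrite ml_kernel_le0 ?leNgt//; under eq_integral do rewrite mul0r.
    by rewrite integral0.
  rewrite ge0_integralZE//.
  - rewrite EFinM EFin_tail_integral; congr (_%:E * _)%E.
    by rewrite /g_ml /ml_kernel r0.
  - apply: measurable_funM => //; apply: (measurableT_comp (measurable_rl_kernel 1)).
    exact: measurable_funB.
  - by move=> y; rewrite mulr_ge0// rl_kernel_ge0.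
rewrite ge0_Tonelli//; apply: eq_integral => y _.
rewrite EFinM -convol_survival /convol -ge0_integralZE//.
- apply: eq_integral => r _; rewrite /f -[in RHS]rl_kernel1_scale; congr EFin.
  rewrite [LHS]mulrC -mulrA [LHS]mulrCA; congr (_ * (rl_kernel 1 _ * _)).
  exact: aux.
- by apply: measurable_convol1 => //; exact: measurable_rl_kernel.
- by move=> r; rewrite mulr_ge0// rl_kernel_ge0.
Qed.

Lemma mass_sub_phi x :
  (total_mass K - phi alpha K c (- x))%:E =
  (\int[mu]_y (K y * survival ((x - y) / c))%:E)%E.
Proof.
pose z := - x.
pose F y := K y * (1 - survival ((y - z) / c)).
pose H y := K y * survival ((y - z) / c).
have ms : measurable_fun setT (fun y : R => survival ((y - z) / c)).
  apply: (measurableT_comp measurable_survival).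
  by apply: measurable_funM => //; exact: measurable_funB.
have mF : measurable_fun setT F.
  by apply: measurable_funM => //; exact: measurable_funB.
have mH : measurable_fun setT H by exact: measurable_funM.
have F0 y : 0 <= F y by rewrite mulr_ge0// subr_ge0 survival_le1.
have H0 y : 0 <= H y by rewrite mulr_ge0// survival_ge0.
have FH : (\int[mu]_y (K y)%:E = \int[mu]_y (F y)%:E + \int[mu]_y (H y)%:E)%E.
  rewrite -ge0_integralDE//; apply: eq_integral => y _; congr EFin.
  by rewrite /F /H -mulrDr subrK mulr1.
have fK : (\int[mu]_y (K y)%:E)%E \is a fin_num by exact: integrable_fin_num.
have := fK; rewrite FH => /[dup]; rewrite fin_numD => /andP[fF fH] _.
have -> : total_mass K = fine (\int[mu]_y (F y)%:E)%E + fine (\int[mu]_y (H y)%:E)%E.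
  by rewrite /total_mass /Rintegral FH fineD.
have -> : phi alpha K c (- x) = fine (\int[mu]_y (F y)%:E)%E.
  by rewrite /phi /Rintegral integral_phi.
rewrite addrAC subrr add0r (fineK fH).
have mHe : measurable_fun setT (fun y => (H y)%:E) by exact/measurable_EFinP.
have H0e y : (0 <= (H y)%:E)%E by rewrite lee_fin.
apply: etrans (ge0_integral_opp mHe H0e) _.
apply: eq_integral => y _; rewrite /H -K_even /z.
have -> : - y - - x = x - y by rewrite opprK addrC.
by [].
Qed.

End representation.

(** * The tail, near and far zones *)
Section tails.
Context {R : realType}.
Local Notation mu := (@lebesgue_measure R).
Variables (K : R -> R) (beta C : R).
Hypothesis iK : mu.-integrable [set: R] (EFin \o K).
Hypothesis beta1 : 1 < beta.
Hypothesis K_decay : x `^ beta * K x @[x --> +oo] --> C.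

Let b0 : 0 < beta - 1. Proof. by rewrite subr_gt0. Qed.

Lemma Rintegral_powR_tail (x : R) : 0 < x ->
  mu.-integrable `[x, +oo[ (EFin \o (fun y => y `^ (- beta))) /\
  \int[mu]_(y in `[x, +oo[) y `^ (- beta) = x `^ (- (beta - 1)) / (beta - 1).
Proof.
move=> x0.
have h : (\int[mu]_(y in `[x, +oo[) (y `^ (- beta))%:E =
    (x `^ (- (beta - 1)) / (beta - 1))%:E)%E.
  by rewrite -(integral_powR_tail b0 x0) (_ : - (beta - 1) - 1 = - beta)//; ring.
split; last by rewrite /Rintegral h.
apply/integrableP; split.
  by apply/measurable_EFinP; apply: measurable_funTS.
under eq_integral do rewrite /= ger0_norm ?powR_ge0//.
by rewrite h ltry.
Qed.

(** Integrate (C - e') y^(-beta) <= K(y) <= (C + e') y^(-beta), where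
e' = e (beta - 1). *)
Lemma tail_asymptotic :
  x `^ (beta - 1) * tail_integral K x @[x --> +oo] --> C / (beta - 1).
Proof.
apply/cvgrPdist_le => e e0.
have e1 : 0 < e * (beta - 1) by rewrite mulr_gt0.
have /cvgrPdist_le/(_ _ e1)[M [_ hM]] := K_decay.
near=> x.
have x0 : 0 < x by near: x; exact: nbhs_pinfty_gt.
have Mx : M < x by near: x; apply: nbhs_pinfty_gt; exact: num_real.
have [ip vp] := Rintegral_powR_tail x0.
have iKx : mu.-integrable `[x, +oo[ (EFin \o K) by exact: integrableS iK.
have iZ r : mu.-integrable `[x, +oo[ (EFin \o (fun y => r * y `^ (- beta))).
  by apply: (integrableZl _ r ip).
have bounds y : x <= y ->
    (C - e * (beta - 1)) * y `^ (- beta) <= K y <= (C + e * (beta - 1)) * y `^ (- beta).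
  move=> xy; have y0 := lt_le_trans x0 xy.
  have := hM y (lt_le_trans Mx xy); rewrite /= ler_distlC.
  by rewrite powRN ler_pdivrMr ?ler_pdivlMr ?powR_gt0// (mulrC (K y)).
have xx : x `^ (beta - 1) * x `^ (- (beta - 1)) = 1.
  by rewrite -powRD ?(gt_eqF x0) ?implybT// subrr powRr0.
have vZ r : x `^ (beta - 1) * (\int[mu]_(y in `[x, +oo[) (r * y `^ (- beta))) =
    r / (beta - 1).
  rewrite RintegralZl// vp mulrCA (mulrA (x `^ _)) xx mul1r//.
rewrite ler_distlC; apply/andP; split.
- have -> : C / (beta - 1) - e = (C - e * (beta - 1)) / (beta - 1).
    by field; rewrite gt_eqF.
  rewrite -vZ ler_pM2l ?powR_gt0//; apply: le_Rintegral => //.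
  by move=> y; rewrite /= in_itv/= andbT => /bounds/andP[].
- have -> : C / (beta - 1) + e = (C + e * (beta - 1)) / (beta - 1).
    by field; rewrite gt_eqF.
  rewrite -vZ ler_pM2l ?powR_gt0//; apply: le_Rintegral => //.
  by move=> y; rewrite /= in_itv/= andbT => /bounds/andP[].
Unshelve. all: by end_near. Qed.

Lemma K_powR_bound : \forall y \near +oo, forall x, y <= x ->
  K x <= (C + 1) * x `^ (- beta).
Proof.
have : \forall y \near +oo, y `^ beta * K y <= C + 1.
  by apply: (cvgr_le _ K_decay); rewrite ltrDl.
move=> [M [_ hM]]; near=> y; move=> x yx.
have y0 : 0 < y by near: y; exact: nbhs_pinfty_gt.
have x0 := lt_le_trans y0 yx.
have Mx : M < x by apply: lt_le_trans yx; near: y; apply: nbhs_pinfty_gt; exact: num_real.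
by have := hM x Mx; rewrite /= powRN ler_pdivlMr ?powR_gt0// (mulrC (K x)).
Unshelve. all: by end_near. Qed.

End tails.

Section near_zone.
Context {R : realType}.
Local Notation mu := (@lebesgue_measure R).

Lemma ge0_integral_affine_reflect (c x : R) (f : R -> \bar R) : 0 < c ->
  measurable_fun setT f -> (forall u, 0 <= f u)%E ->
  (\int[mu]_y f ((x - y) / c)%R = c%:E * \int[mu]_u f u)%E.
Proof.
move=> c0 mf f0; have ci0 : 0 < c^-1 by rewrite invr_gt0.
have mfc : measurable_fun setT (fun y : R => f (y / c)).
  by apply: (measurableT_comp mf); exact: measurable_funM.
rewrite (@ge0_integral_reflect _ x (fun y : R => f (y / c)))//.
rewrite (ge0_integral_affine 0 ci0 mf f0) muleA -EFinM divff ?gt_eqF// mul1e.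
by apply: eq_integral => y _; rewrite addr0 mulrC.
Qed.

Variables alpha c : R.
Hypothesis alpha0 : 0 < alpha.
Hypothesis alpha1 : alpha < 1.
Hypothesis c0 : 0 < c.
Variables (K : R -> R) (beta C : R).
Hypothesis mK : measurable_fun [set: R] K.
Hypothesis K0 : forall x, 0 <= K x.
Hypothesis beta1 : 1 < beta.
Hypothesis C0 : 0 <= C.
Hypothesis K_decay : x `^ beta * K x @[x --> +oo] --> C.

Definition near_part (x y : R) : R :=
  if (x / 2 <= y) && (y < x) then K y * survival alpha ((x - y) / c) else 0.

Lemma measurable_survival_affine (x : R) :
  measurable_fun setT (fun y : R => survival alpha ((x - y) / c)).
Proof.
apply: (measurableT_comp (measurable_survival alpha0)).
by apply: measurable_funM => //; exact: measurable_funB.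
Qed.

Lemma measurable_near_part x : measurable_fun setT (near_part x).
Proof.
apply: measurable_fun_ifT => //.
  by apply: measurable_and; [exact: measurable_fun_ler|exact: measurable_fun_ltr].
by apply: measurable_funM => //; exact: measurable_survival_affine.
Qed.

Lemma near_part_ge0 x y : 0 <= near_part x y.
Proof.
rewrite /near_part; case: ifP => // _.
exact: mulr_ge0 (K0 y) (survival_ge0 alpha0 alpha1 _).
Qed.

(** K is at most (C + 1) (x / 2)^(-beta) on the zone, and the integral of S there is
at most c h_2(x / c) = O(x^(1-alpha)). *)
Lemma near_part_le : exists2 D : R, 0 <= D & \forall x \near +oo,
  (\int[mu]_y (near_part x y)%:E <= (D * x `^ (1 - alpha - beta))%:E)%E.
Proof.
have q0 : 0 < 2 - alpha by rewrite subr_gt0 (lt_trans alpha1) ?ltr1n.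
have [M [_ hM]] := K_powR_bound K_decay.
have G0 := Gamma_gt0 q0.
exists ((C + 1) * 2^-1 `^ (- beta) * (c * (c^-1 `^ (1 - alpha) / Gamma (2 - alpha)))).
  by rewrite !mulr_ge0 ?invr_ge0 ?powR_ge0 ?addr_ge0 ?(ltW c0) ?(ltW G0).
near=> x.
have x0 : 0 < x by near: x; exact: nbhs_pinfty_gt.
have x20 : 0 < x / 2 by rewrite divr_gt0.
have xM : M < x / 2.
  by rewrite ltr_pdivlMr//; near: x; apply: nbhs_pinfty_gt; exact: num_real.
pose A := (C + 1) * (x / 2) `^ (- beta).
have A0 : 0 <= A by rewrite mulr_ge0 ?powR_ge0 ?addr_ge0.
have S0 (u : R) : 0 <= ml_kernel alpha 1 u by exact: ml_kernel_ge0.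
pose f (u : R) := rl_kernel 1 (x / c - u) * ml_kernel alpha 1 u.
have mf : measurable_fun setT f by exact: measurable_ml_convol.
have f0 u : 0 <= f u by rewrite mulr_ge0 ?rl_kernel_ge0.
have mfx : measurable_fun setT (fun y : R => f ((x - y) / c)).
  apply: (measurableT_comp mf).
  by apply: measurable_funM => //; exact: measurable_funB.
have xc0 : 0 < x / c by rewrite divr_gt0.
apply: (@le_trans _ _ (A * (c * ml_kernel alpha 2 (x / c)))%:E); last first.
  rewrite lee_fin /A powRM ?invr_ge0 ?(ltW x0)//.
  rewrite (_ : 1 - alpha - beta = - beta + (1 - alpha)); last by ring.
  rewrite (@powRD _ x (- beta)) ?(gt_eqF x0) ?implybT//.
  rewrite [leRHS](_ : _ = (C + 1) * (x `^ (- beta) * 2^-1 `^ (- beta)) *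
    (c * (x `^ (1 - alpha) * c^-1 `^ (1 - alpha) / Gamma (2 - alpha)))); last by ring.
  apply: ler_wpM2l; first by rewrite !mulr_ge0 ?powR_ge0 ?addr_ge0.
  apply: ler_wpM2l; first exact: ltW.
  apply: le_trans (ml_kernel2_le alpha0 alpha1 xc0) _.
  rewrite /rl_kernel /pospow xc0 (_ : 2 - alpha - 1 = 1 - alpha); last by ring.
  by rewrite powRM ?invr_ge0 ?(ltW x0) ?(ltW c0).
have -> : ((A * (c * ml_kernel alpha 2 (x / c)))%:E =
    \int[mu]_y (A * f ((x - y) / c))%:E)%E.
  have hf : (\int[mu]_u (f u)%:E = (ml_kernel alpha 2 (x / c))%:E)%E.
    by have := convol_ml_kernel alpha0 (x / c) ltr01 ltr01.
  have mfe : measurable_fun setT (fun u => (f u)%:E).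
    by apply/measurable_EFinP; exact: mf.
  have f0e u : (0 <= (f u)%:E)%E by rewrite lee_fin.
  have fA0 y : 0 <= f ((x - y) / c) by exact: f0.
  apply: etrans _ (esym (ge0_integralZE A0 mfx fA0)).
  by rewrite (ge0_integral_affine_reflect x c0 mfe f0e) hf !EFinM.
apply: ge0_le_integralE => //.
- exact: measurable_near_part.
- exact: measurable_funM.
- exact: near_part_ge0.
- move=> y; rewrite /near_part; case: ifPn => [/andP[xy yx]|_]; last exact: mulr_ge0.
  have u0 : 0 < (x - y) / c by rewrite divr_gt0// subr_gt0.
  rewrite /survival u0 /f rl_kernel1; last first.
    by rewrite subr_gt0 ltr_pM2r ?invr_gt0// gtrBl (lt_le_trans x20).
  rewrite mul1r; apply: ler_wpM2r => //.
  apply: le_trans (hM y (lt_le_trans xM xy) y (lexx y)) _.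
  apply: ler_wpM2l; first by rewrite addr_ge0.
  apply: ge0_powR_antitone => //.
  by rewrite oppr_le0 ltW// (lt_trans ltr01).
Unshelve. all: by end_near. Qed.

End near_zone.

Section far_zone.
Context {R : realType}.
Local Notation mu := (@lebesgue_measure R).
Variables alpha c : R.
Hypothesis alpha0 : 0 < alpha.
Hypothesis alpha1 : alpha < 1.
Hypothesis c0 : 0 < c.
Variable K : R -> R.
Hypothesis iK : mu.-integrable [set: R] (EFin \o K).
Hypothesis mK : measurable_fun [set: R] K.
Hypothesis K0 : forall x, 0 <= K x.

(** Holds for infinite X as well, because the real part of an infinity is 0. *)
Lemma fine_mulZ (a : R) (X : \bar R) : fine (a%:E * X) = a * fine X.
Proof.
case: X => [r| |] //=; rewrite mulr0.
- have [a0|a0|->] := ltgtP a 0; last by rewrite mul0e.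
  + by rewrite lt0_muley.
  + by rewrite gt0_muley.
- have [a0|a0|->] := ltgtP a 0; last by rewrite mul0e.
  + by rewrite lt0_muleNy.
  + by rewrite gt0_muleNy.
Qed.

(** The condition 0 < x makes the domination below hold for every x, so that it
can be used along sequences which are positive only eventually. *)
Definition far_part (x y : R) : R :=
  if (0 < x) && (y < x / 2) then K y * survival alpha ((x - y) / c) else 0.

Lemma measurable_far_part x : measurable_fun setT (far_part x).
Proof.
apply: measurable_fun_ifT => //.
  by apply: measurable_and => //; exact: measurable_fun_ltr.
by apply: measurable_funM => //; exact: measurable_survival_affine.
Qed.

Lemma far_part_ge0 x y : 0 <= far_part x y.
Proof.
rewrite /far_part; case: ifP => // _.
exact: mulr_ge0 (K0 y) (survival_ge0 alpha0 alpha1 _).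
Qed.

(** On the zone (x - y) / c >= x / (2 c), and S is O of the power - alpha. *)
Lemma far_part_dominated x y :
  x `^ alpha * far_part x y <= Gamma (alpha + 1) * (2 * c) `^ alpha * K y.
Proof.
have G0 : 0 < Gamma (alpha + 1) by apply: Gamma_gt0; rewrite addr_gt0.
have h0 : 0 <= Gamma (alpha + 1) * (2 * c) `^ alpha * K y.
  by rewrite !mulr_ge0 ?powR_ge0 ?(ltW G0).
rewrite /far_part; case: ifPn => [/andP[x0 yx]|_]; last by rewrite mulr0.
have c20 : 0 < 2 * c by rewrite mulr_gt0.
have xc0 : 0 < x / (2 * c) by rewrite divr_gt0.
have xu : x / (2 * c) <= (x - y) / c.
  rewrite invfM mulrA ler_pM2r ?invr_gt0// lerBrDr.
  by rewrite -lerBrDl; apply: ltW; move: yx; lra.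
have u0 := lt_le_trans xc0 xu.
rewrite /survival u0 mulrCA [leRHS]mulrC; apply: ler_wpM2l => //.
apply: (@le_trans _ _ (x `^ alpha * (Gamma (alpha + 1) * (x / (2 * c)) `^ (- alpha)))).
  apply: ler_wpM2l; first exact: powR_ge0.
  apply: le_trans (relax_le_powR alpha0 alpha1 u0) _.
  apply: ler_wpM2l; first exact: ltW.
  by apply: ge0_powR_antitone => //; rewrite oppr_le0 ltW.
rewrite powRN powRM ?invr_ge0 ?(ltW x0) ?(ltW c20)//.
rewrite -[(2 * c)^-1]powR_inv1 ?(ltW c20)// -powRrM mulN1r powRN.
have := powR_gt0 alpha x0; have := powR_gt0 alpha c20.
move: (Gamma _) (_ `^ _) (_ `^ _) => G A B A0 B0.
by rewrite le_eqVlt; apply/orP; left; apply/eqP; field; rewrite !gt_eqF.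
Qed.

(** Write x^alpha S(u), u = (x - y) / c, as (x / u)^alpha times u^alpha S(u); the
ratio x / u = c / (1 - y / x) tends to c. *)
Lemma far_part_cvg y :
  x `^ alpha * far_part x y @[x --> +oo] --> K y * (c `^ alpha / Gamma (1 - alpha)).
Proof.
have cvg_inv : y * x^-1 @[x --> +oo] --> y * 0.
  by apply: cvgMl_tmp; apply/gtr0_cvgV0; [exact: nbhs_pinfty_gt|exact: cvg_id].
have cvg_ratio : c / (1 - y * x^-1) @[x --> +oo] --> c / (1 - y * 0).
  apply: cvgMl_tmp; apply: cvgV; first by rewrite mulr0 subr0.
  by apply: cvgB => //; exact: cvg_cst.
rewrite mulr0 subr0 divr1 in cvg_ratio.
have cvg_pow : (c / (1 - y * x^-1)) `^ alpha @[x --> +oo] --> c `^ alpha.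
  apply: (@continuous_cvg _ _ _ _ _ _ (fun x : R => x `^ alpha)) => //.
  exact: continuous_powR_gt0.
have cvg_u : (x - y) / c @[x --> +oo] --> +oo.
  apply/cvgryPge => A; near=> x; rewrite ler_pdivlMr// lerBrDr.
  by near: x; apply: nbhs_pinfty_ge; exact: num_real.
have cvg_S : ((x - y) / c) `^ alpha * ml_kernel alpha 1 ((x - y) / c) @[x --> +oo] -->
    (Gamma (1 - alpha))^-1.
  exact: (cvg_comp _ (fun t => t `^ alpha * ml_kernel alpha 1 t) cvg_u
    (relax_asymptotic alpha0 alpha1)).
have h : K y * ((c / (1 - y * x^-1)) `^ alpha *
    (((x - y) / c) `^ alpha * ml_kernel alpha 1 ((x - y) / c))) @[x --> +oo] -->
    K y * (c `^ alpha / Gamma (1 - alpha)).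
  by apply: cvgMl_tmp; exact: cvgM.
apply: cvg_trans h; apply: near_eq_cvg; near=> x.
have x0 : 0 < x by near: x; exact: nbhs_pinfty_gt.
have yx : y < x / 2.
  by rewrite ltr_pdivlMr//; near: x; apply: nbhs_pinfty_gt; exact: num_real.
have xy : 0 < x - y by move: x0 yx; lra.
have u0 : 0 < (x - y) / c by rewrite divr_gt0.
rewrite /far_part x0 yx/= /survival u0 [RHS]mulrCA; congr (_ * _).
rewrite mulrA; congr (_ * _).
have -> : c / (1 - y * x^-1) = c * x / (x - y).
  field; rewrite gt_eqF//= gt_eqF//; move: xy; lra.
rewrite -powRM ?(ltW u0) ?divr_ge0 ?mulr_ge0 ?(ltW c0) ?(ltW x0) ?(ltW xy)//.
by congr (_ `^ _); field; rewrite !gt_eqF.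
Unshelve. all: by end_near. Qed.

Lemma far_part_asymptotic :
  x `^ alpha * fine (\int[mu]_y (far_part x y)%:E)%E @[x --> +oo] -->
  total_mass K * c `^ alpha / Gamma (1 - alpha).
Proof.
apply/cvg_pinftyP => u uoo.
set L := c `^ alpha / Gamma (1 - alpha).
have iKc r : mu.-integrable setT (fun y => (r * K y)%:E) by exact: (integrableZl _ r iK).
have D0 : 0 <= Gamma (alpha + 1) * (2 * c) `^ alpha.
  by rewrite mulr_ge0 ?powR_ge0// ltW// Gamma_gt0// addr_gt0.
pose f n y := (u n `^ alpha * far_part (u n) y)%:E.
have f0 n y : (0 <= f n y)%E.
  by rewrite lee_fin mulr_ge0 ?powR_ge0 ?far_part_ge0.
have mf n : measurable_fun setT (f n).
  by apply/measurable_EFinP; apply: measurable_funM => //; exact: measurable_far_part.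
have := @dominated_convergence _ _ _ mu setT measurableT f
  (fun y => (L * K y)%:E) (fun y => (Gamma (alpha + 1) * (2 * c) `^ alpha * K y)%:E) mf.
case.
- by apply/measurable_EFinP; exact: measurable_funM.
- apply: aeW => y _; apply: cvg_EFin; first exact: nearW.
  rewrite [L * K y]mulrC.
  by have /cvg_pinftyP := @far_part_cvg y; exact.
- exact: iKc.
- apply: aeW => y n _; rewrite gee0_abs// lee_fin; exact: far_part_dominated.
move=> _ _ h.
have fE n : (\int[mu]_y f n y = (u n `^ alpha)%:E * \int[mu]_y (far_part (u n) y)%:E)%E.
  apply: ge0_integralZE; first exact: powR_ge0.
  - exact: measurable_far_part.
  - exact: far_part_ge0.
have Lfin : (\int[mu]_y (L * K y)%:E =
    (total_mass K * c `^ alpha / Gamma (1 - alpha))%:E)%E.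
  have L0 : 0 <= L by rewrite divr_ge0 ?powR_ge0// ltW// Gamma_gt0// subr_gt0.
  rewrite (ge0_integralZE L0 mK K0) /total_mass /Rintegral.
  rewrite -mulrA -/L mulrC [RHS]EFinM fineK//; exact: integrable_fin_num.
move: h; rewrite Lfin => h.
have -> : (fun n => u n `^ alpha * fine (\int[mu]_y (far_part (u n) y)%:E)%E) =
    fine \o (fun n => \int[mu]_y f n y)%E; last exact: fine_cvg.
by apply/funext => n /=; rewrite fE fine_mulZ.
Qed.

End far_zone.

(** * Comparison of the zones *)
Section assembly.
Context {R : realType}.
Local Notation mu := (@lebesgue_measure R).
Variables alpha c : R.
Hypothesis alpha0 : 0 < alpha.
Hypothesis alpha1 : alpha < 1.
Hypothesis c0 : 0 < c.
Variables (K : R -> R) (beta C : R).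
Hypothesis iK : mu.-integrable [set: R] (EFin \o K).
Hypothesis mK : measurable_fun [set: R] K.
Hypothesis K0 : forall x, 0 <= K x.
Hypothesis K_even : forall x, K x = K (- x).
Hypothesis beta1 : 1 < beta.
Hypothesis C0 : 0 <= C.
Hypothesis K_decay : x `^ beta * K x @[x --> +oo] --> C.

Local Notation A := (fun x => fine (\int[mu]_y (far_part alpha c K x y)%:E)%E).
Local Notation B := (fun x => fine (\int[mu]_y (near_part alpha c K x y)%:E)%E).

Lemma mass_sub_phi_split (x : R) : 0 < x ->
  total_mass K - phi alpha K c (- x) = A x + B x + tail_integral K x.
Proof.
move=> x0; pose tail (y : R) := if x <= y then K y else 0.
have mtail : measurable_fun setT tail.
  by apply: measurable_fun_ifT => //; exact: measurable_fun_ler.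
have tail0 y : 0 <= tail y by rewrite /tail; case: ifP.
have mfar := measurable_far_part c alpha0 mK x.
have far0 := far_part_ge0 c alpha0 alpha1 K0 x.
have mnear := measurable_near_part c alpha0 mK x.
have near0 := near_part_ge0 c alpha0 alpha1 K0 x.
have tailE : (\int[mu]_y (tail y)%:E)%E = (tail_integral K x)%:E.
  have ixK : mu.-integrable `[x, +oo[ (EFin \o K) by exact: integrableS iK.
  rewrite /tail_integral /Rintegral fineK; last exact: integrable_fin_num.
  rewrite [RHS]integral_mkcond; apply: eq_integral => y _.
  by rewrite patchE mem_setE in_itv/= andbT /tail; case: ifP.
have e : (total_mass K - phi alpha K c (- x))%:E =
    (\int[mu]_y (far_part alpha c K x y)%:E + \int[mu]_y (near_part alpha c K x y)%:E +
     \int[mu]_y (tail y)%:E)%E.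
  rewrite (mass_sub_phi alpha0 alpha1 c0 iK mK K0 K_even).
  rewrite -ge0_integralDE// -ge0_integralDE//; first last.
  - by move=> y; rewrite addr_ge0.
  - exact: measurable_funD.
  apply: eq_integral => y _; congr EFin.
  rewrite /far_part /near_part /tail x0/=.
  have [yx2|x2y] := ltP y (x / 2).
    have yx : y < x by apply: lt_trans yx2 _; rewrite gtr_pMr// invf_lt1// ltr1n.
    by rewrite leNgt yx/= !addr0.
  have [yx|xy] := ltP y x; first by rewrite addr0 add0r.
  by rewrite !add0r /survival ltNge pmulr_lle0 ?invr_gt0// subr_le0 xy/= mulr1.
have : (\int[mu]_y (far_part alpha c K x y)%:E + \int[mu]_y (near_part alpha c K x y)%:E +
     \int[mu]_y (tail y)%:E)%E \is a fin_num by rewrite -e.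
rewrite fin_numD => /andP[]; rewrite fin_numD => /andP[fA fB] _.
apply: EFin_inj; rewrite e tailE !EFinD.
by rewrite (fineK fA) (fineK fB).
Qed.

Lemma near_part_negligible (p : R) : p + (1 - alpha - beta) < 0 ->
  x `^ p * B x @[x --> +oo] --> (0 : R).
Proof.
move=> p0; have [D D0 hD] := near_part_le alpha0 alpha1 c0 mK K0 beta1 C0 K_decay.
apply: (@squeeze_cvgr _ _ _ _ (cst 0)
  (fun x => D * x `^ (- (- (p + (1 - alpha - beta)))))).
- near=> x; have x0 : 0 < x by near: x; exact: nbhs_pinfty_gt.
  have i0 : (0 <= \int[mu]_y (near_part alpha c K x y)%:E)%E.
    by apply: integral_ge0 => y _; rewrite lee_fin; exact: near_part_ge0.
  have le : (\int[mu]_y (near_part alpha c K x y)%:E <= (D * x `^ (1 - alpha - beta))%:E)%E.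
    by near: x.
  rewrite /= mulr_ge0 ?powR_ge0 ?fine_ge0//= opprK.
  rewrite powRD ?(gt_eqF x0) ?implybT// mulrCA ler_pM2l ?powR_gt0//.
  by rewrite -lee_fin fineK// ge0_fin_numE// (le_lt_trans le) ?ltry.
- exact: cvg_cst.
- have h : D * x `^ (- (- (p + (1 - alpha - beta)))) @[x --> +oo] --> D * 0.
    by apply: cvgMl_tmp; apply: cvgr_powRN; rewrite oppr_gt0.
  by rewrite mulr0 in h.
Unshelve. all: by end_near. Qed.

Lemma cvg_smaller_power (f : R -> R) (p q l : R) : p < q ->
  x `^ q * f x @[x --> +oo] --> l -> x `^ p * f x @[x --> +oo] --> (0 : R).
Proof.
move=> pq fl; have h : x `^ (- (q - p)) * (x `^ q * f x) @[x --> +oo] --> 0 * l.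
  by apply: cvgM => //; apply: cvgr_powRN; rewrite subr_gt0.
rewrite mul0r in h; apply: cvg_trans h; apply: near_eq_cvg; near=> x.
have x0 : 0 < x by near: x; exact: nbhs_pinfty_gt.
by rewrite mulrA -powRD ?(gt_eqF x0) ?implybT// opprB subrK.
Unshelve. all: by end_near. Qed.

Lemma cvg_mass_sub_phi (p lA lD : R) : p + (1 - alpha - beta) < 0 ->
  x `^ p * A x @[x --> +oo] --> lA ->
  x `^ p * tail_integral K x @[x --> +oo] --> lD ->
  `|z| `^ p * (total_mass K - phi alpha K c z) @[z --> -oo] --> lD + lA.
Proof.
move=> pneg hA hD; apply/cvgNy_compNP.
have h : x `^ p * A x + x `^ p * B x + x `^ p * tail_integral K x @[x --> +oo] -->
    lA + 0 + lD.
  by apply: cvgD => //; apply: cvgD => //; exact: near_part_negligible.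
rewrite addr0 addrC in h; apply: cvg_trans h; apply: near_eq_cvg; near=> x.
have x0 : 0 < x by near: x; exact: nbhs_pinfty_gt.
by rewrite /= normrN gtr0_norm// mass_sub_phi_split// !mulrDr.
Unshelve. all: by end_near. Qed.

End assembly.

Unset Implicit Arguments.
Set Strict Implicit.

Theorem proposition6p2 (R : realType) (alpha c : R) (K : R -> R)
    (beta C_alg : R)
    (alpha_gt0 : 0 < alpha) (alpha_lt1 : alpha < 1) (c_gt0 : 0 < c)
    (K_L1 : lebesgue_measure.-integrable [set: R] (EFin \o K))
    (K_bounded : [bounded K x | x in [set: R]])
    (K_continuous : continuous K)
    (K_ge0 : forall x : R, 0 <= K x)
    (K0_gt0 : 0 < K 0)
    (K_even : forall x : R, K x = K (- x))
    (beta_gt1 : 1 < beta) (C_alg_ge0 : 0 <= C_alg)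
    (K_decay : x `^ beta * K x @[x --> +oo] --> C_alg) :
  let kappa := total_mass K in
  [/\ beta < 1 + alpha ->
        `|z| `^ (beta - 1) * (kappa - phi alpha K c z) @[z --> -oo]
          --> C_alg / (beta - 1),
      beta = 1 + alpha ->
        `|z| `^ alpha * (kappa - phi alpha K c z) @[z --> -oo]
          --> C_alg / (beta - 1) + kappa * c `^ alpha / Gamma (1 - alpha)
    & beta > 1 + alpha ->
        `|z| `^ alpha * (kappa - phi alpha K c z) @[z --> -oo]
          --> kappa * c `^ alpha / Gamma (1 - alpha)].
Proof.
move=> kappa.
have mK : measurable_fun [set: R] K by exact: continuous_measurable_fun.
have main := cvg_mass_sub_phi alpha_gt0 alpha_lt1 c_gt0 K_L1 mK K_ge0 K_even
  beta_gt1 C_alg_ge0 K_decay.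
have far := far_part_asymptotic alpha_gt0 alpha_lt1 c_gt0 K_L1 mK K_ge0.
have tail := tail_asymptotic K_L1 beta_gt1 K_decay.
have alpha_exponent : alpha + (1 - alpha - beta) < 0.
  by rewrite addrA subrKC subr_lt0.
split.
- move=> beta_lt; rewrite -[C_alg / _]addr0; apply: main => //.
    by rewrite (_ : _ + _ = - alpha) ?oppr_lt0//; ring.
  by apply: cvg_smaller_power far; rewrite ltrBlDl.
- move=> beta_eq; apply: main => //.
  by rewrite (_ : alpha = beta - 1)// beta_eq addrAC subrr add0r.
- move=> beta_gt; rewrite -[kappa * _ / _]add0r; apply: main => //.
  by apply: cvg_smaller_power tail; rewrite ltrBrDl.
Qed.
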